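(* Let $N$ be a positive integer, $A\in\mathbb{R}\setminus\{0\}$, $B\in\mathbb{R}$, $\lambda>0$, and $\alpha_o,\beta_o\in(0,\infty)$. Let $\{\Phi_j\}_{j\in\{1,\dots,N\}}\subset L^2(\mathbb{R},dx)$ be a finite collection of non-zero functions such that the support of each $\widehat{\Phi_j}$ is contained in an interval of length $\lambda$. For each $j\in\{1,\dots,N\}$ let $p_0^{(j)}$ and $q_0^{(j)}$ be real numbers such that $|p_0^{(j)}q_0^{(j)}|<1$ and $q_0^{(j)}=\frac{1}{\lambda}$. Then $\{\Phi_{(n,l,j)}^{A,B}\}_{n,l\in\mathbb{Z},\,j\in\{1,\dots,N\}}$ is a frame (a Gabor frame) for $L^2(\mathbb{R},dx)$ with frame bounds $\alpha_o,\beta_o$ if and only if $$\alpha_o\le \lambda\sum_{j=1}^{N}\sum_{l\in\mathbb{Z}}\big|\widehat{\Phi_j}(\gamma-Ap_0^{(j)}l)\big|^2\le\beta_o\quad\text{for almost all }\gamma\in\mathbb{R}.$$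
   Context: The Fourier transform is $\widehat f(\gamma)=\int_{\mathbb{R}}f(x)e^{-2\pi i x\gamma}\,dx$. A countable family $\{\varphi_k\}_{k}$ in a separable Hilbert space $\mathcal H$ is a frame for $\mathcal H$ with (not necessarily optimal) frame bounds $\alpha,\beta\in(0,\infty)$ if $\alpha\|f\|^2\le\sum_k|\langle f,\varphi_k\rangle|^2\le\beta\|f\|^2$ for all $f\in\mathcal H$. For $n,l\in\mathbb{Z}$ and $j\in\{1,\dots,N\}$, the Gabor system coming from the Weyl--Heisenberg group is $$\Phi_{(n,l,j)}^{A,B}(x)=e^{2\pi i[\frac12 Anlp_0^{(j)}q_0^{(j)}+Blp_0^{(j)}]}\,e^{2\pi i Alp_0^{(j)}x}\,\Phi_j(x+nq_0^{(j)}),\qquad x\in\mathbb{R}.$$ (Equivalently, $\Phi_{(n,l,j)}^{A,B}=\Theta^{A,B}\big(nq_0^{(j)},(\tfrac{nlq_0^{(j)}p_0^{(j)}}{2},lp_0^{(j)})\big)\Phi_j$, where $(\Theta^{A,B}(c,(y_1,y_2))f)(x)=e^{2\pi i[A(y_1+xy_2)+By_2]}f(c+x)$.) *)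

(* Defs.v *)
From HB Require Import structures.
From mathcomp Require Import all_boot all_order all_algebra.
From mathcomp Require Import complex.
From mathcomp Require Import all_classical all_reals all_analysis.

Set Implicit Arguments.
Unset Strict Implicit.
Unset Printing Implicit Defensive.

Import Order.TTheory GRing.Theory Num.Theory.
Import numFieldNormedType.Exports.

Local Open Scope classical_set_scope.
Local Open Scope ring_scope.
Local Open Scope complex_scope.

(* The library's L^p spaces are real-valued. Here the elements of L^2(R, dx)
   are represented by complex-valued functions on the line, and everything
   below is invariant under almost everywhere equality. *)

Definition cabs (R : realType) (z : R[i]) : R := ComplexField.Normc.normc z.

(* expi t = e^{2 pi i t} *)
Definition expi (R : realType) (t : R) : R[i] :=
  cos (2 * pi * t) +i* sin (2 * pi * t).

Definition cintegral (R : realType) (D : set R) (f : R -> R[i]) : R[i] :=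
  (\int[@lebesgue_measure R]_(x in D) complex.Re (f x))%R
  +i* (\int[@lebesgue_measure R]_(x in D) complex.Im (f x))%R.

Definition cmeasurable (R : realType) (f : R -> R[i]) : Prop :=
  measurable_fun [set: R] (fun x => complex.Re (f x)) /\
  measurable_fun [set: R] (fun x => complex.Im (f x)).

Definition sqnorm2 (R : realType) (f : R -> R[i]) : \bar R :=
  (\int[@lebesgue_measure R]_(x in [set: R]) (cabs (f x) ^+ 2)%:E)%E.

Definition L2 (R : realType) (f : R -> R[i]) : Prop :=
  cmeasurable f /\ (sqnorm2 f < +oo)%E.

Definition inner2 (R : realType) (f g : R -> R[i]) : R[i] :=
  cintegral [set: R] (fun x => f x * conjc (g x)).

Definition ae_zero (R : realType) (f : R -> R[i]) : Prop :=
  {ae @lebesgue_measure R, forall x, f x = 0}.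

Definition fourier_on (R : realType) (D : set R) (f : R -> R[i]) (gamma : R) :
    R[i] :=
  cintegral D (fun x => f x * expi (- (x * gamma))).

(* For f in L^2 the integral defining the Fourier transform need not converge
   absolutely: as usual it is the L^2 limit of the integrals over [-n, n]
   (Plancherel), which agrees a.e. with the integral over R if f is also in
   L^1. It is determined up to a.e. equality. *)
Definition is_fourier (R : realType) (f g : R -> R[i]) : Prop :=
  L2 g /\
  sqnorm2 (fun gamma => g gamma - fourier_on `[- n%:R, n%:R] f gamma)
    @[n --> \oo] --> 0%E.

Definition fourier (R : realType) (f : R -> R[i]) : R -> R[i] :=
  xget (fun=> 0) [set g | is_fourier f g].

(* The support of an a.e. class: the complement of the largest open set on
   which it vanishes a.e. *)
Definition ess_support (R : realType) (f : R -> R[i]) : set R :=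
  ~` (\bigcup_(U in [set U : set R | open U /\
        {ae @lebesgue_measure R, forall x, U x -> f x = 0}]) U).

(* J ranges over all intervals, open, closed or half-open. *)
Definition supported_in_interval_of_length (R : realType) (f : R -> R[i])
    (len : R) : Prop :=
  exists J : interval R,
    lebesgue_measure [set` J] = len%:E /\ ess_support f `<=` [set` J].

Definition is_frame_L2 (R : realType) (I : countType) (phi : I -> R -> R[i])
    (alpha beta : R) : Prop :=
  [/\ 0 < alpha, 0 < beta, forall k, L2 (phi k) &
   forall f, L2 f ->
     (alpha%:E * sqnorm2 f
        <= \esum_(k in [set: I]) (cabs (inner2 f (phi k)) ^+ 2)%:E
        <= beta%:E * sqnorm2 f)%E].

Definition gabor (R : realType) (N : nat) (A B : R) (p0 q0 : 'I_N -> R)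
    (Phi : 'I_N -> R -> R[i]) (k : int * int * 'I_N) (x : R) : R[i] :=
  let: (n, l, j) := k in
  expi (2^-1 * A * n%:~R * l%:~R * p0 j * q0 j + B * l%:~R * p0 j)
  * expi (A * l%:~R * p0 j * x)
  * Phi j (x + n%:~R * q0 j).

(* Main.v *)
(* On the Fourier side the element of index (n, l, j) is, up to a unimodular
   factor, the product of e^{2 pi i n gamma / lambda} and of Phihat_j translated by
   A p_j l. For fixed (l, j) the coefficients of f are thus the Fourier coefficients
   of fhat . conj (Phihat_j (. - A p_j l)), which lives on an interval of length
   lambda, and Parseval gives
     sum_n |<f, Phi_(n,l,j)>|^2
       = lambda int |fhat(gamma)|^2 |Phihat_j(gamma - A p_j l)|^2 dgamma.
   Summing over l and j yields int |fhat|^2 W, where W is the sum in the theorem.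
   Bounds on W give the frame bounds, and conversely letting fhat run through the
   indicators of sets of finite measure recovers the bounds on W almost everywhere.

   Plancherel's theorem is deduced from Parseval for Fourier series by averaging
   over all translates of the dual lattice. The exponentials are complete in a
   period because the indicator of an arc is a bounded pointwise limit of
   polynomials in a cosine. *)

Require Import Defs.
From HB Require Import structures.
From mathcomp Require Import all_boot all_order all_algebra.
From mathcomp Require Import complex ring lra.
From mathcomp Require Import all_classical all_reals all_analysis.
From mathcomp Require Import measurable_realfun.

Set Implicit Arguments.
Unset Strict Implicit.
Unset Printing Implicit Defensive.

Import Order.TTheory GRing.Theory Num.Theory.
Import numFieldNormedType.Exports.

Local Open Scope classical_set_scope.
Local Open Scope ring_scope.
Local Open Scope complex_scope.

(** The condition q = 1/lambda is a duality: translation by multiples of 1/lambda becomes, on the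
    Fourier side, multiplication by the exponentials of period lambda, which form an orthogonal
    basis over any interval of length lambda. The transform is given only as an L^2 limit, through a
    choice operator. Its existence therefore rests on the completeness of L^2, and its properties
    are shown for compactly supported functions, where the integral converges absolutely, and then
    carried over by continuity of the inner product. Identities between transforms hold only almost
    everywhere, so functions are cut off by indicators wherever a support has to be exact. Testing
    on indicators requires the transform to be onto; the candidate for the inverse comes from the
    symmetry of the kernel exp(-2 pi i x y). A further obstacle is that the product of fhat with a
    translate of Phihat_j is a priori only integrable, whereas Parseval wants it square integrable.
    Each direction of the equivalence supplies this in its own way: an upper bound on W makes
    Phihat_j essentially bounded, and an indicator is itself bounded. *)

Section complex_numbers.
Context {R : realType}.
Implicit Types (z w : R[i]) (s t : R).

Lemma cabs_ge0 z : 0 <= cabs z.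
Proof. by case: z => a b; rewrite /cabs/= sqrtr_ge0. Qed.

Lemma sqr_cabs z : cabs z ^+ 2 = complex.Re z ^+ 2 + complex.Im z ^+ 2.
Proof. by case: z => a b; rewrite /cabs/= sqr_sqrtr// addr_ge0 ?sqr_ge0. Qed.

Lemma cabsM z w : cabs (z * w) = cabs z * cabs w.
Proof. exact: ComplexField.Normc.normcM. Qed.

Lemma cabs_conj z : cabs (conjc z) = cabs z.
Proof. by case: z => a b; rewrite /cabs/= sqrrN. Qed.

Lemma cabsN z : cabs (- z) = cabs z.
Proof. by rewrite /cabs normcN. Qed.

Lemma cabs_real s : cabs s%:C = `|s|.
Proof. by rewrite /cabs/= expr0n/= addr0 sqrtr_sqr. Qed.

Lemma cabs0 : cabs (0 : R[i]) = 0.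
Proof. by rewrite /cabs ComplexField.Normc.normc0. Qed.

Lemma cabs_eq0 z : cabs z = 0 -> z = 0.
Proof. exact: ComplexField.Normc.eq0_normc. Qed.

Lemma cabs_expi t : cabs (expi t) = 1.
Proof. by rewrite /cabs/= cos2Dsin2 sqrtr1. Qed.

Lemma le_cabsD z w : cabs (z + w) <= cabs z + cabs w.
Proof. exact: le_normcD. Qed.

Lemma normr_Re_le z : `|complex.Re z| <= cabs z.
Proof.
by rewrite -ler_sqr ?nnegrE ?cabs_ge0//
   sqr_cabs real_normK ?num_real// lerDl sqr_ge0.
Qed.

Lemma normr_Im_le z : `|complex.Im z| <= cabs z.
Proof.
by rewrite -ler_sqr ?nnegrE ?cabs_ge0//
   sqr_cabs real_normK ?num_real// lerDr sqr_ge0.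
Qed.

Lemma cReM z w : complex.Re (z * w) =
  complex.Re z * complex.Re w - complex.Im z * complex.Im w.
Proof. by case: z w => [a b] [c d]. Qed.

Lemma cImM z w : complex.Im (z * w) =
  complex.Re z * complex.Im w + complex.Im z * complex.Re w.
Proof. by case: z w => [a b] [c d]. Qed.

Lemma cReD z w : complex.Re (z + w) = complex.Re z + complex.Re w.
Proof. by case: z w => [a b] [c d]. Qed.

Lemma cImD z w : complex.Im (z + w) = complex.Im z + complex.Im w.
Proof. by case: z w => [a b] [c d]. Qed.

Lemma cReN z : complex.Re (- z) = - complex.Re z.
Proof. by case: z. Qed.

Lemma cImN z : complex.Im (- z) = - complex.Im z.
Proof. by case: z. Qed.

Lemma cReJ z : complex.Re (conjc z) = complex.Re z.
Proof. by case: z. Qed.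

Lemma cImJ z : complex.Im (conjc z) = - complex.Im z.
Proof. by case: z. Qed.

Lemma eq_ReIm z w : complex.Re z = complex.Re w -> complex.Im z = complex.Im w ->
  z = w.
Proof. by case: z w => [a b] [c d] /= -> ->. Qed.

Lemma cJM z w : conjc (z * w) = conjc z * conjc w.
Proof. exact: rmorphM. Qed.

Lemma mulcJ z : z * conjc z = (cabs z ^+ 2)%:C.
Proof. by rewrite sqr_cabs; case: z => a b; apply: eq_ReIm => /=; ring. Qed.

Lemma expiD s t : expi (s + t) = expi s * expi t.
Proof. by apply: eq_ReIm; rewrite /= mulrDr ?cosD ?sinD//=; ring. Qed.

Lemma expi0 : expi (0 : R) = 1.
Proof. by rewrite /expi mulr0 cos0 sin0. Qed.

Lemma conj_expi t : conjc (expi t) = expi (- t).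
Proof. by rewrite /expi/= mulrN cosN sinN. Qed.

Lemma expi_nat (n : nat) : expi (n%:R : R) = 1.
Proof.
elim: n => [|n IH]; first exact: expi0.
rewrite -natr1 expiD IH mul1r /expi mulr1.
by rewrite mulrC mulr_natr cos2pi sin2pi.
Qed.

Lemma expi_int (n : int) : expi (n%:~R : R) = 1.
Proof.
case: n => n; first exact: expi_nat.
by rewrite NegzE intrN -conj_expi expi_nat conjc1.
Qed.

End complex_numbers.

(** * Measurability, null sets and translations of the line *)

Section complex_measurable.
Context {R : realType}.
Implicit Types f g : R -> R[i].

Lemma cmeasurable_cst (z : R[i]) : cmeasurable (fun=> z : R[i]).
Proof. by split; exact: measurable_cst. Qed.

Lemma cmeasurableD f g : cmeasurable f -> cmeasurable g ->
  cmeasurable (fun x => f x + g x).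
Proof.
move=> [fr fi] [gr gi]; split.
- by under eq_fun do rewrite cReD; exact: measurable_funD.
- by under eq_fun do rewrite cImD; exact: measurable_funD.
Qed.

Lemma cmeasurableM f g : cmeasurable f -> cmeasurable g ->
  cmeasurable (fun x => f x * g x).
Proof.
move=> [fr fi] [gr gi]; split.
- under eq_fun do rewrite cReM.
  by apply: measurable_funB; exact: measurable_funM.
- under eq_fun do rewrite cImM.
  by apply: measurable_funD; exact: measurable_funM.
Qed.

Lemma cmeasurableJ f : cmeasurable f -> cmeasurable (fun x => conjc (f x)).
Proof.
move=> [fr fi]; split.
- by under eq_fun do rewrite cReJ.
- by under eq_fun do rewrite cImJ; exact: measurable_funN.
Qed.

Lemma cmeasurableN f : cmeasurable f -> cmeasurable (fun x => - f x).
Proof.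
move=> [fr fi]; split.
- by under eq_fun do rewrite cReN; exact: measurable_funN.
- by under eq_fun do rewrite cImN; exact: measurable_funN.
Qed.

Lemma cmeasurableB f g : cmeasurable f -> cmeasurable g ->
  cmeasurable (fun x => f x - g x).
Proof. by move=> mf mg; apply: cmeasurableD => //; exact: cmeasurableN. Qed.

Lemma cmeasurable_comp f (h : R -> R) : measurable_fun setT h ->
  cmeasurable f -> cmeasurable (fun x => f (h x)).
Proof.
move=> mh [fr fi]; split.
- exact: (measurableT_comp fr mh).
- exact: (measurableT_comp fi mh).
Qed.

Lemma cmeasurable_real (h : R -> R) : measurable_fun setT h ->
  cmeasurable (fun x => (h x)%:C).
Proof. by move=> mh; split => //; exact: measurable_cst. Qed.

Lemma cmeasurable_expi (h : R -> R) : measurable_fun setT h ->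
  cmeasurable (fun x => expi (h x)).
Proof.
move=> mh; split => /=.
- apply: (measurableT_comp (f := @cos R)); last exact: measurable_funM.
  exact: continuous_measurable_fun (@continuous_cos R).
- apply: (measurableT_comp (f := @sin R)); last exact: measurable_funM.
  exact: continuous_measurable_fun (@continuous_sin R).
Qed.

Lemma measurable_sqr_cabs f : cmeasurable f ->
  measurable_fun setT (fun x => cabs (f x) ^+ 2).
Proof.
move=> [fr fi]; under eq_fun do rewrite sqr_cabs.
by apply: measurable_funD; exact: measurable_funX.
Qed.

Lemma measurable_cabs f : cmeasurable f ->
  measurable_fun setT (fun x => cabs (f x)).
Proof.
move=> mf; rewrite [X in measurable_fun _ X](_ : _ =
  (fun x => Num.sqrt (cabs (f x) ^+ 2))); last first.
  by apply/funext => x; rewrite sqrtr_sqr ger0_norm// cabs_ge0.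
apply: (measurableT_comp (f := @Num.sqrt R)); last exact: measurable_sqr_cabs.
exact: continuous_measurable_fun (@sqrt_continuous R).
Qed.

End complex_measurable.

Section almost_everywhere.
Context {R : realType}.
Notation mu := (@lebesgue_measure R).
Implicit Types P Q : R -> Prop.

Lemma aeS P Q : (forall x, P x -> Q x) ->
  {ae mu, forall x, P x} -> {ae mu, forall x, Q x}.
Proof.
move=> PQ [A [mA A0 nP]]; exists A; split => // x /= nQ.
by apply: nP => /= /PQ.
Qed.

Lemma ae_forall (P : nat -> R -> Prop) :
  (forall n, {ae mu, forall x, P n x}) -> {ae mu, forall x, forall n, P n x}.
Proof.
move=> aeP; have := @negligible_bigcup _ _ _ mu (fun n => ~` [set x | P n x]) aeP.
by apply: negligibleS => x /= /existsNP[n nP]; exists n.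
Qed.

Lemma aeI P Q : {ae mu, forall x, P x} -> {ae mu, forall x, Q x} ->
  {ae mu, forall x, P x /\ Q x}.
Proof.
move=> aeP aeQ.
have /ae_forall : forall n : nat, {ae mu, forall x, if n is 0%N then P x else Q x}.
  by case.
by apply: aeS => x PQ; split; [exact: (PQ 0%N)|exact: (PQ 1%N)].
Qed.

Lemma ae_true P : (forall x, P x) -> {ae mu, forall x, P x}.
Proof. by move=> aP; exists set0; split => // x /= nP; exact: (nP (aP x)). Qed.

End almost_everywhere.

Section translation.
Context {R : realType}.
Notation mu := (@lebesgue_measure R).
Local Open Scope ereal_scope.

Lemma measurable_shift (s : R) : measurable_fun setT (fun x : R => (x + s)%R).
Proof. exact: measurable_funD. Qed.

(** The pushforward gives every half-open interval its length, and this property determines Lebesgue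
    measure. *)
Lemma lebesgue_measure_shift (s : R) (A : set R) : measurable A ->
  pushforward mu ((fun x => x + s)%R : _ -> measurableTypeR R) A = mu A.
Proof.
move=> mA; apply/esym/lebesgue_measure_unique => //=; first exact: measurable_shift.
move=> ms _ [[a b]] _ <-.
rewrite /pushforward (_ : _ @^-1` _ = `](a - s)%R, (b - s)%R]%classic); last first.
  by apply/seteqP; split => x /=; rewrite !in_itv/= ltrBlDr lerBrDr.
rewrite !lebesgue_measure_itv/= !lte_fin ltrD2r.
by case: ifPn => // _; rewrite -!EFinB; congr EFin; ring.
Qed.

Lemma ge0_integral_shift (s : R) (f : R -> \bar R) :
  measurable_fun setT f -> (forall x, 0 <= f x) ->
  \int[mu]_x f (x + s)%R = \int[mu]_x f x.
Proof.
move=> mf f0.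
have ms : measurable_fun [set: measurableTypeR R]
    ((fun x => x + s)%R : _ -> measurableTypeR R) by exact: measurable_shift.
rewrite -(preimage_setT (fun x : R => (x + s)%R)).
rewrite -[LHS](ge0_integral_pushforward ms mu measurableT mf)//.
by apply: eq_measure_integral => A mA _; exact: lebesgue_measure_shift.
Qed.

Lemma integral_shift (s : R) (f : R -> \bar R) : measurable_fun setT f ->
  \int[mu]_x f (x + s)%R = \int[mu]_x f x.
Proof.
move=> mf; rewrite integralE [RHS]integralE.
rewrite -(@ge0_integral_shift s f^\+)//; last exact: measurable_funepos.
rewrite -(@ge0_integral_shift s f^\-)//; last exact: measurable_funeneg.
by congr (_ - _); apply: eq_integral => x _; rewrite ?funeposE ?funenegE.
Qed.

Lemma ae_shift (s : R) (P : set R) :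
  {ae mu, forall x, P x} -> {ae mu, forall x, P (x + s)%R}.
Proof.
move=> [A [mA A0 PA]]; exists ((fun x => x + s)%R @^-1` A); split.
- by rewrite -[_ @^-1` _]setTI; exact: measurable_shift.
- by have := lebesgue_measure_shift s mA; rewrite /pushforward A0.
- by move=> x /= nP; exact: PA.
Qed.

End translation.

(** * Complex-valued integrals and L^2 *)

Section complex_integral.
Context {R : realType}.
Notation mu := (@lebesgue_measure R).
Implicit Types (f g : R -> R[i]) (z : R[i]).

Definition cintegrable f := mu.-integrable setT (EFin \o (fun x => complex.Re (f x)))
  /\ mu.-integrable setT (EFin \o (fun x => complex.Im (f x))).

Lemma cintegrable_cmeasurable f : cintegrable f -> cmeasurable f.
Proof.
by move=> [/measurable_int/measurable_EFinP ? /measurable_int/measurable_EFinP].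
Qed.

Lemma le_cintegrable f (h : R -> R) : cmeasurable f ->
  mu.-integrable setT (EFin \o h) -> (forall x, cabs (f x) <= h x) ->
  cintegrable f.
Proof.
move=> [fr fi] ih fh; split; apply: le_integrable ih => //=.
- exact/measurable_EFinP.
- move=> x _; rewrite lee_fin (le_trans (normr_Re_le _))// (le_trans (fh x))//.
  exact: ler_norm.
- exact/measurable_EFinP.
- move=> x _; rewrite lee_fin (le_trans (normr_Im_le _))// (le_trans (fh x))//.
  exact: ler_norm.
Qed.

Lemma cintegrable_cabs f : cintegrable f ->
  mu.-integrable setT (EFin \o (fun x => cabs (f x))).
Proof.
move=> fi; have [fr fim] := fi.
have mf := cintegrable_cmeasurable fi.
apply: (@le_integrable _ _ _ mu setT measurableT _
  (EFin \o (fun x => `|complex.Re (f x)| + `|complex.Im (f x)|))) => //=.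
- by apply/measurable_EFinP; exact: measurable_cabs.
- move=> x _; rewrite lee_fin ger0_norm ?cabs_ge0// [leRHS]ger0_norm ?addr_ge0//.
  rewrite -ler_sqr ?nnegrE ?cabs_ge0 ?addr_ge0// sqr_cabs sqrrD.
  by rewrite !real_normK ?num_real// addrAC lerDl mulrn_wge0// mulr_ge0.
- rewrite (_ : EFin \o _ = (EFin \o (fun x => `|complex.Re (f x)|)%R) \+
    (EFin \o (fun x => `|complex.Im (f x)|)%R))%E//.
  by apply: integrableD => //; exact: integrable_norm.
Qed.

Lemma cintegrableD f g : cintegrable f -> cintegrable g ->
  cintegrable (fun x => f x + g x).
Proof.
move=> [fr fi] [gr gi]; split.
- by under eq_fun do rewrite cReD; exact: (integrableD measurableT fr gr).
- by under eq_fun do rewrite cImD; exact: (integrableD measurableT fi gi).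
Qed.

Lemma cintegrableMbdd f (h : R -> R[i]) (M : R) : cmeasurable h ->
  (forall x, cabs (h x) <= M) -> cintegrable f ->
  cintegrable (fun x => h x * f x).
Proof.
move=> mh hM fi; have mf := cintegrable_cmeasurable fi.
apply: (@le_cintegrable _ (fun x => M * cabs (f x))).
- exact: cmeasurableM.
- by have := integrableZl measurableT M (cintegrable_cabs fi).
- by move=> x; rewrite cabsM ler_wpM2r// cabs_ge0.
Qed.

Lemma cintegrableZ f z : cintegrable f -> cintegrable (fun x => z * f x).
Proof. by move=> fi; exact: (cintegrableMbdd (cmeasurable_cst z) (fun=> lexx _) fi). Qed.

Lemma eq_cintegral f g : f =1 g -> cintegral setT f = cintegral setT g.
Proof. by move=> fg; congr cintegral; exact/funext. Qed.

Lemma cintegralD f g : cintegrable f -> cintegrable g ->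
  cintegral setT (fun x => f x + g x) = cintegral setT f + cintegral setT g.
Proof.
move=> [fr fi] [gr gi]; apply: eq_ReIm => /=.
- by under eq_Rintegral do rewrite cReD; rewrite RintegralD.
- by under eq_Rintegral do rewrite cImD; rewrite RintegralD.
Qed.

Lemma cintegralZ f z : cintegrable f ->
  cintegral setT (fun x => z * f x) = z * cintegral setT f.
Proof.
move=> [fr fi]; apply: eq_ReIm => /=.
- under eq_Rintegral do rewrite cReM.
  rewrite RintegralB//; last 2 first.
    exact: (integrableZl measurableT _ fr).
    exact: (integrableZl measurableT _ fi).
  by rewrite !RintegralZl// cReM.
- under eq_Rintegral do rewrite cImM.
  rewrite RintegralD//; last 2 first.
    exact: (integrableZl measurableT _ fi).
    exact: (integrableZl measurableT _ fr).
  by rewrite !RintegralZl// cImM.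
Qed.

Lemma cintegralJ f : cintegrable f ->
  cintegral setT (fun x => conjc (f x)) = conjc (cintegral setT f).
Proof.
move=> [fr fi]; apply: eq_ReIm; rewrite ?cReJ ?cImJ /=.
- by under eq_Rintegral do rewrite cReJ.
- under eq_Rintegral do rewrite cImJ -mulN1r.
  by rewrite RintegralZl// mulN1r.
Qed.

Lemma cintegral_shift (s : R) f : cmeasurable f ->
  cintegral setT (fun x => f (x + s)) = cintegral setT f.
Proof.
move=> [fr fi]; apply: eq_ReIm => /=; congr fine.
- by rewrite -(@integral_shift R s (EFin \o (fun x => complex.Re (f x))))//;
    exact/measurable_EFinP.
- by rewrite -(@integral_shift R s (EFin \o (fun x => complex.Im (f x))))//;
    exact/measurable_EFinP.
Qed.

Lemma ae_eq_cintegral f g : cmeasurable f -> cmeasurable g ->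
  {ae mu, forall x, f x = g x} -> cintegral setT f = cintegral setT g.
Proof.
move=> [fr fi] [gr gi] fg; apply: eq_ReIm => /=; congr fine.
- apply: ae_eq_integral => //; [exact/measurable_EFinP..|].
  by apply: aeS fg => x -> _.
- apply: ae_eq_integral => //; [exact/measurable_EFinP..|].
  by apply: aeS fg => x -> _.
Qed.

(** The linearity and translation lemmas are about integrals over the whole line; an integral over D
    is brought to that form. *)
Lemma cintegral_mkcond (D : set R) f :
  cintegral D f = cintegral setT (fun x => (\1_D x)%:C * f x).
Proof.
apply: eq_ReIm => /=; rewrite Rintegral_mkcond; apply: eq_Rintegral => x _ /=;
  rewrite ?cReM ?cImM/= mul0r ?subr0 ?addr0 indicE/= patchE;
  by case: (x \in D); rewrite /= ?mul1r ?mul0r.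
Qed.

End complex_integral.

Section square_integrable.
Context {R : realType}.
Notation mu := (@lebesgue_measure R).
Implicit Types (f g h : R -> R[i]) (z : R[i]).

(** The square of the norm. Since [fine] sends +oo to 0, the value is meaningful only under [L2], as
    in [sqnorm2E]. *)
Definition nrm2 f : R := fine (sqnorm2 f).

Lemma measurable_sqr_cabs_EFin f : cmeasurable f ->
  measurable_fun setT (fun x => (cabs (f x) ^+ 2)%:E).
Proof. by move=> mf; apply/measurable_EFinP; exact: measurable_sqr_cabs. Qed.

Lemma sqnorm2_ge0 f : (0 <= sqnorm2 f)%E.
Proof. by apply: integral_ge0 => x _; rewrite lee_fin sqr_ge0. Qed.

Lemma nrm2_ge0 f : 0 <= nrm2 f.
Proof. by rewrite fine_ge0// sqnorm2_ge0. Qed.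

Lemma sqnorm2E f : L2 f -> sqnorm2 f = (nrm2 f)%:E.
Proof. by move=> [_ foo]; rewrite fineK// ge0_fin_numE// sqnorm2_ge0. Qed.

Lemma L2_cmeasurable f : L2 f -> cmeasurable f.
Proof. by case. Qed.

Lemma L2_integrable f : L2 f ->
  mu.-integrable setT (EFin \o (fun x => cabs (f x) ^+ 2)).
Proof.
move=> [mf foo]; apply/integrableP; split.
  exact: measurable_sqr_cabs_EFin.
rewrite [ltLHS](_ : _ = sqnorm2 f)//; apply: eq_integral => x _.
by rewrite gee0_abs// lee_fin sqr_ge0.
Qed.

Lemma integrable_L2 f (h : R -> R) : cmeasurable f ->
  mu.-integrable setT (EFin \o h) ->
  (forall x, cabs (f x) ^+ 2 <= h x) -> L2 f.
Proof.
move=> mf /integrableP[mh hoo] fh; split => //; apply: le_lt_trans hoo; rewrite /sqnorm2.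
apply: ge0_le_integral => //.
- by move=> x _; rewrite lee_fin sqr_ge0.
- exact: measurable_sqr_cabs_EFin.
- exact: measurableT_comp.
- by move=> x _; rewrite lee_fin (le_trans (fh x))// ler_norm.
Qed.

Lemma le_L2 f g (K : R) : cmeasurable f -> L2 g ->
  (forall x, cabs (f x) ^+ 2 <= K * cabs (g x) ^+ 2) -> L2 f.
Proof.
move=> mf Lg; apply: integrable_L2 => //.
exact: (integrableZl measurableT K (L2_integrable Lg)).
Qed.

Lemma sqr_cabsD_le z (w : R[i]) :
  cabs (z + w) ^+ 2 <= 2 * (cabs z ^+ 2 + cabs w ^+ 2).
Proof.
rewrite !sqr_cabs; case: z w => [a b] [c d] /=.
have := sqr_ge0 (a - c); have := sqr_ge0 (b - d); nra.
Qed.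

Lemma L2D f g : L2 f -> L2 g -> L2 (fun x => f x + g x).
Proof.
move=> Lf Lg; apply: (@integrable_L2 _
  (fun x => 2 * (cabs (f x) ^+ 2 + cabs (g x) ^+ 2))).
- by apply: cmeasurableD; exact: L2_cmeasurable.
- exact: (integrableZl measurableT 2
    (integrableD measurableT (L2_integrable Lf) (L2_integrable Lg))).
- by move=> x; exact: sqr_cabsD_le.
Qed.

Lemma L2Mbdd f h (M : R) : cmeasurable h -> (forall x, cabs (h x) <= M) ->
  L2 f -> L2 (fun x => h x * f x).
Proof.
move=> mh hM Lf; apply: (@le_L2 _ f (M ^+ 2)) => //.
  by apply: cmeasurableM => //; exact: L2_cmeasurable.
move=> x; rewrite cabsM exprMn ler_wpM2r ?sqr_ge0//.
by rewrite ler_sqr ?nnegrE ?cabs_ge0// (le_trans _ (hM x))// cabs_ge0.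
Qed.

Lemma L2Z f z : L2 f -> L2 (fun x => z * f x).
Proof. exact: L2Mbdd (cmeasurable_cst z) (fun=> lexx _). Qed.

Lemma L2N f : L2 f -> L2 (fun x => - f x).
Proof. by move=> Lf; under eq_fun do rewrite -mulN1r; exact: L2Z. Qed.

Lemma L2B f g : L2 f -> L2 g -> L2 (fun x => f x - g x).
Proof. by move=> Lf Lg; apply: L2D => //; exact: L2N. Qed.

Lemma L2J f : L2 f -> L2 (fun x => conjc (f x)).
Proof.
move=> Lf; apply: (@le_L2 _ f 1) => //.
- exact/cmeasurableJ/L2_cmeasurable.
- by move=> x; rewrite cabs_conj mul1r.
Qed.

Lemma L2_expi f (k : R -> R) : measurable_fun setT k -> L2 f ->
  L2 (fun x => expi (k x) * f x).
Proof.
move=> mk; apply: (@L2Mbdd _ _ 1); first exact: cmeasurable_expi.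
by move=> x; rewrite cabs_expi.
Qed.

Lemma cabs_indic (A : set R) x : cabs ((\1_A x)%:C : R[i]) <= 1.
Proof. by rewrite cabs_real indicE normr_nat; case: (_ \in _). Qed.

Lemma cmeasurable_indic (A : set R) : measurable A ->
  cmeasurable (fun x => (\1_A x)%:C : R[i]).
Proof. by move=> mA; apply: cmeasurable_real; exact: measurable_indic. Qed.

Lemma L2_indic f (A : set R) : measurable A -> L2 f ->
  L2 (fun x => (\1_A x)%:C * f x).
Proof.
move=> mA; apply: (@L2Mbdd _ _ 1); first exact: cmeasurable_indic.
exact: cabs_indic.
Qed.

Lemma L2_0 : L2 (fun=> 0 : R[i]).
Proof.
split; first exact: cmeasurable_cst.
by rewrite /sqnorm2 integral0_eq// => x _; rewrite cabs0 expr0n.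
Qed.

Lemma L2_sum (I : Type) (s : seq I) (F : I -> R -> R[i]) :
  (forall i, L2 (F i)) -> L2 (fun x => \sum_(i <- s) F i x).
Proof.
move=> LF; elim: s => [|i s IH].
  by under eq_fun do rewrite big_nil; exact: L2_0.
by under eq_fun do rewrite big_cons; exact: L2D.
Qed.

Lemma sqnorm2_shift f (s : R) : cmeasurable f ->
  sqnorm2 (fun x => f (x + s)) = sqnorm2 f.
Proof.
move=> mf; rewrite /sqnorm2.
rewrite (@integral_shift R s (fun x => (cabs (f x) ^+ 2)%:E))//.
exact: measurable_sqr_cabs_EFin.
Qed.

Lemma L2_shift f (s : R) : L2 f -> L2 (fun x => f (x + s)).
Proof.
move=> [mf foo]; split; last by rewrite sqnorm2_shift.
by apply: cmeasurable_comp => //; exact: measurable_shift.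
Qed.

Lemma eq_sqnorm2 f g : (forall x, cabs (f x) = cabs (g x)) ->
  sqnorm2 f = sqnorm2 g.
Proof. by move=> fg; apply: eq_integral => x _; rewrite fg. Qed.

Lemma ae_eq_sqnorm2 f g : cmeasurable f -> cmeasurable g ->
  {ae mu, forall x, cabs (f x) = cabs (g x)} -> sqnorm2 f = sqnorm2 g.
Proof.
move=> mf mg fg; apply: ae_eq_integral => //.
- exact: measurable_sqr_cabs_EFin.
- exact: measurable_sqr_cabs_EFin.
- by apply: aeS fg => x -> _.
Qed.

Lemma cintegrable_mulJ f g : L2 f -> L2 g ->
  cintegrable (fun x => f x * conjc (g x)).
Proof.
move=> Lf Lg; apply: (@le_cintegrable _ _
  (fun x => cabs (f x) ^+ 2 + cabs (g x) ^+ 2)).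
- apply: cmeasurableM; first exact: L2_cmeasurable.
  exact/cmeasurableJ/L2_cmeasurable.
- exact: (integrableD measurableT (L2_integrable Lf) (L2_integrable Lg)).
- move=> x; rewrite cabsM cabs_conj.
  have := cabs_ge0 (f x); have := cabs_ge0 (g x).
  have := sqr_ge0 (cabs (f x) - cabs (g x)); nra.
Qed.

Lemma cintegrable_mul f g : L2 f -> L2 g -> cintegrable (fun x => f x * g x).
Proof.
move=> Lf Lg; have := cintegrable_mulJ Lf (L2J Lg).
by under eq_fun do rewrite conjcK.
Qed.

Lemma inner2D f1 f2 g : L2 f1 -> L2 f2 -> L2 g ->
  inner2 (fun x => f1 x + f2 x) g = inner2 f1 g + inner2 f2 g.
Proof.
move=> L1 L2 Lg; rewrite -cintegralD; [|exact: cintegrable_mulJ..].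
by apply: eq_cintegral => x; rewrite mulrDl.
Qed.

Lemma inner2Z z f g : L2 f -> L2 g ->
  inner2 (fun x => z * f x) g = z * inner2 f g.
Proof.
move=> Lf Lg; rewrite -cintegralZ; last exact: cintegrable_mulJ.
by apply: eq_cintegral => x; rewrite mulrA.
Qed.

Lemma inner2C f g : L2 f -> L2 g -> inner2 g f = conjc (inner2 f g).
Proof.
move=> Lf Lg; rewrite -cintegralJ; last exact: cintegrable_mulJ.
by apply: eq_cintegral => x; rewrite rmorphM/= conjcK mulrC.
Qed.

Lemma inner2B f1 f2 g : L2 f1 -> L2 f2 -> L2 g ->
  inner2 (fun x => f1 x - f2 x) g = inner2 f1 g - inner2 f2 g.
Proof.
move=> L1 L2 Lg; rewrite inner2D//; last exact: L2N.
congr (_ + _); under eq_fun do rewrite -mulN1r.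
by rewrite inner2Z// mulN1r.
Qed.

Lemma inner2Dr f g1 g2 : L2 f -> L2 g1 -> L2 g2 ->
  inner2 f (fun x => g1 x + g2 x) = inner2 f g1 + inner2 f g2.
Proof.
move=> Lf L1 L2; rewrite inner2C ?inner2D//; last exact: L2D.
by rewrite (inner2C L1 Lf) (inner2C L2 Lf) rmorphD.
Qed.

Lemma inner2Br f g1 g2 : L2 f -> L2 g1 -> L2 g2 ->
  inner2 f (fun x => g1 x - g2 x) = inner2 f g1 - inner2 f g2.
Proof.
move=> Lf L1 L2; rewrite inner2C ?inner2B//; last exact: L2B.
by rewrite (inner2C L1 Lf) (inner2C L2 Lf) rmorphB.
Qed.

Lemma inner2Zr z f g : L2 f -> L2 g ->
  inner2 f (fun x => z * g x) = conjc z * inner2 f g.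
Proof.
move=> Lf Lg; rewrite inner2C ?inner2Z//; last exact: L2Z.
by rewrite (inner2C Lg Lf) rmorphM.
Qed.

Lemma inner2_diag f : inner2 f f = (nrm2 f)%:C.
Proof.
apply: eq_ReIm => /=.
- by congr fine; apply: eq_integral => x _; rewrite mulcJ.
- rewrite /Rintegral integral0_eq//= => x _; by rewrite mulcJ.
Qed.

Lemma nrm2E f : nrm2 f = complex.Re (inner2 f f).
Proof. by rewrite inner2_diag. Qed.

Lemma nrm2D f g : L2 f -> L2 g -> nrm2 (fun x => f x + g x) =
  nrm2 f + nrm2 g + 2 * complex.Re (inner2 f g).
Proof.
move=> Lf Lg; have LD := L2D Lf Lg.
rewrite [LHS]nrm2E (inner2D Lf Lg LD) (inner2Dr Lf Lf Lg) (inner2Dr Lg Lf Lg).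
rewrite (inner2C Lf Lg) (nrm2E f) (nrm2E g).
move: (inner2 f f) (inner2 g g) (inner2 f g) => [a b] [c d] [u v] /=; ring.
Qed.

Lemma nrm2Z z f : L2 f -> nrm2 (fun x => z * f x) = cabs z ^+ 2 * nrm2 f.
Proof.
move=> Lf; rewrite nrm2E inner2Z//; last exact: L2Z.
by rewrite inner2Zr// inner2_diag mulrA mulcJ cReM/= mul0r subr0.
Qed.

Lemma nrm2N f : nrm2 (fun x => - f x) = nrm2 f.
Proof. by rewrite /nrm2; congr fine; apply: eq_sqnorm2 => x; rewrite cabsN. Qed.

Lemma nrm2B f g : L2 f -> L2 g -> nrm2 (fun x => f x - g x) =
  nrm2 f + nrm2 g - 2 * complex.Re (inner2 f g).
Proof.
move=> Lf Lg; rewrite nrm2D//; last exact: L2N.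
rewrite nrm2N; congr (_ + _); rewrite -mulrN; congr (_ * _).
have -> : (fun x => - g x) = (fun x => -1 * g x).
  by apply/funext => x; rewrite mulN1r.
by rewrite inner2Zr// rmorphN rmorph1 mulN1r cReN.
Qed.

Lemma nrm2BC f g : nrm2 (fun x => f x - g x) = nrm2 (fun x => g x - f x).
Proof. by rewrite -nrm2N; congr nrm2; apply/funext => x; rewrite opprB. Qed.

(** By the parallelogram law. It stands in for the triangle inequality and avoids square roots; the
    constant 2 is harmless when limits are taken. *)
Lemma nrm2D_le f g : L2 f -> L2 g ->
  nrm2 (fun x => f x + g x) <= 2 * (nrm2 f + nrm2 g).
Proof.
move=> Lf Lg; have := nrm2_ge0 (fun x => f x - g x).
by rewrite nrm2B// nrm2D//; lra.
Qed.

Lemma nrm2B_le f g h : L2 f -> L2 g -> L2 h ->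
  nrm2 (fun x => f x - h x) <=
  2 * (nrm2 (fun x => f x - g x) + nrm2 (fun x => g x - h x)).
Proof.
move=> Lf Lg Lh; apply: le_trans (nrm2D_le (L2B Lf Lg) (L2B Lg Lh)).
by under [X in _ <= nrm2 X]eq_fun do rewrite addrA subrK.
Qed.

(** With w = <f, g> and s real, the squared norm of f - s w g is a nonnegative quadratic in s; its
    minimum is at s = 1 / [nrm2 g]. *)
Lemma cauchy_schwarz f g : L2 f -> L2 g ->
  cabs (inner2 f g) ^+ 2 <= nrm2 f * nrm2 g.
Proof.
move=> Lf Lg; set w := inner2 f g.
have P (s : R) : 0 <= nrm2 f + s ^+ 2 * cabs w ^+ 2 * nrm2 g
    - 2 * s * cabs w ^+ 2.
  have := nrm2_ge0 (fun x => f x - (s%:C * w) * g x).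
  rewrite nrm2B//; last exact: L2Z.
  rewrite nrm2Z// inner2Zr// -/w cabsM cabs_real exprMn real_normK ?num_real//.
  suff -> : complex.Re (conjc (s%:C * w) * w) = s * cabs w ^+ 2.
    by move=> ?; lra.
  by rewrite sqr_cabs; case: (w) => a b /=; ring.
have [g0|g0] := eqVneq (nrm2 g) 0.
  rewrite g0 mulr0; have [//|w0] := leP (cabs w ^+ 2) 0.
  (* When [nrm2 g] is 0 the inequality is affine in s, and this s would make its right-hand side
     negative. *)
  have := P ((nrm2 f + 1) / cabs w ^+ 2); rewrite g0 mulr0 addr0.
  rewrite -mulrA mulfVK ?gt_eqF//.
  by have := nrm2_ge0 f; lra.
have {}g0 : 0 < nrm2 g by rewrite lt_neqAle eq_sym g0 nrm2_ge0.
set v := (nrm2 g)^-1; have vg : v * nrm2 g = 1 by rewrite mulVf ?gt_eqF.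
have := P v; rewrite (_ : v ^+ 2 * _ * _ = v * cabs w ^+ 2 * (v * nrm2 g)); last by ring.
rewrite vg => H; have : v * cabs w ^+ 2 <= nrm2 f by lra.
rewrite -(ler_pM2r g0) (_ : v * _ * _ = cabs w ^+ 2 * (v * nrm2 g)); last by ring.
by rewrite vg mulr1.
Qed.

Lemma nrm2_eq0 (h : R -> R[i]) : L2 h -> ae_zero h -> nrm2 h = 0.
Proof.
move=> Lh h0; rewrite /nrm2 (@ae_eq_sqnorm2 _ (fun=> 0)).
- by rewrite /sqnorm2 integral0_eq// => x _; rewrite cabs0 expr0n.
- exact: L2_cmeasurable.
- exact: cmeasurable_cst.
- by apply: aeS h0 => x ->.
Qed.

Lemma nrm2_ae_eq f g : L2 f -> L2 g -> nrm2 (fun x => f x - g x) = 0 ->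
  {ae mu, forall x, f x = g x}.
Proof.
move=> Lf Lg; have Lfg := L2B Lf Lg => fg0.
have : sqnorm2 (fun x => f x - g x) = 0%E by rewrite sqnorm2E// fg0.
have mfg := measurable_sqr_cabs_EFin (L2_cmeasurable Lfg).
have := @ae_eq_integral_abs _ _ _ mu setT measurableT
  (fun x => (cabs (f x - g x) ^+ 2)%:E).
move=> /(_ mfg)[H _] fg0'.
have /H : (\int[mu]_x `|(cabs (f x - g x) ^+ 2)%:E| = 0)%E.
  by rewrite -fg0'; apply: eq_integral => x _; rewrite gee0_abs// lee_fin sqr_ge0.
apply: aeS => x /(_ I) [] /eqP.
by rewrite sqrf_eq0 => /eqP/cabs_eq0/eqP; rewrite subr_eq0 => /eqP.
Qed.

End square_integrable.

(** * Completeness of L^2 *)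

Section riesz_fischer.
Context {R : realType}.
Notation mu := (@lebesgue_measure R).

Lemma geometric_increments_cvg (u : nat -> R) (C : R) : 0 <= C ->
  (forall k, `|u k.+1 - u k| <= C * 2^-1 ^+ k) -> cvgn u.
Proof.
move=> C0 uC; have : cvgn (series (telescope u)).
  apply: normed_cvg; apply: (@series_le_cvg _ _ (geometric C 2^-1)) => [n|n|n|].
  - exact: normr_ge0.
  - by rewrite geometric_ge0.
  - exact: uC.
  - by apply: is_cvg_geometric_series; rewrite ger0_norm// invf_lt1// ltr1n.
rewrite telescopeK => /(is_cvgD (is_cvg_cst (u 0%N))).
rewrite [X in cvgn X -> _](_ : _ = u)//.
by apply/funext => n /=; rewrite !fctE /= addrC subrK.
Qed.

Lemma limn_einf_ub (u : nat -> \bar R) (c : \bar R) : (forall n, (u n <= c)%E) ->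
  (limn_einf u <= c)%E.
Proof.
move=> uc; rewrite limn_einf_lim; apply: lime_le; first exact: is_cvg_einfs.
apply: nearW => n; apply: le_trans (uc n); apply: ereal_inf_lbound.
by exists n => //=.
Qed.

Lemma cmeasurable_cvg (H : nat -> R -> R[i]) (h : R -> R[i]) :
  (forall n, cmeasurable (H n)) ->
  (forall x, complex.Re (H n x) @[n --> \oo] --> complex.Re (h x)) ->
  (forall x, complex.Im (H n x) @[n --> \oo] --> complex.Im (h x)) ->
  cmeasurable h.
Proof.
move=> mH rH iH; split.
- apply: (@measurable_fun_cvg _ _ _ _ (fun n x => complex.Re (H n x))) => //.
  by move=> n; case: (mH n).
- apply: (@measurable_fun_cvg _ _ _ _ (fun n x => complex.Im (H n x))) => //.
  by move=> n; case: (mH n).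
Qed.

Lemma fatou_sqnorm2 (H : nat -> R -> R[i]) (h : R -> R[i]) (c : \bar R) :
  (forall n, cmeasurable (H n)) ->
  (forall x, complex.Re (H n x) @[n --> \oo] --> complex.Re (h x)) ->
  (forall x, complex.Im (H n x) @[n --> \oo] --> complex.Im (h x)) ->
  (forall n, (sqnorm2 (H n) <= c)%E) -> (sqnorm2 h <= c)%E.
Proof.
move=> mH rH iH Hc; apply: le_trans (limn_einf_ub Hc).
rewrite /sqnorm2 [leLHS](_ : _ =
  \int[mu]_x limn_einf (fun n => (cabs (H n x) ^+ 2)%:E))%E; last first.
  apply: eq_integral => x _; apply/esym.
  apply: (fun H => (@cvg_limn_einf_sup _ _ _ H).1).
  apply: cvg_EFin; first exact: nearW.
  under eq_fun do rewrite /= sqr_cabs !expr2.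
  by rewrite sqr_cabs !expr2; apply: cvgD; apply: cvgM.
apply: (@fatou _ _ _ mu _ measurableT (fun n x => (cabs (H n x) ^+ 2)%:E)).
- by move=> n; exact: measurable_sqr_cabs_EFin.
- by move=> n x _; rewrite lee_fin sqr_ge0.
Qed.

Theorem riesz_fischer (F : nat -> R -> R[i]) : (forall n, L2 (F n)) ->
  (forall e, 0 < e -> exists N, forall m n, (N <= m)%N -> (N <= n)%N ->
    nrm2 (fun x => F m x - F n x) <= e) ->
  exists2 g, L2 g & nrm2 (fun x => F n x - g x) @[n --> \oo] --> 0.
Proof.
move=> LF cauF.
(* The increments D k of the subsequence satisfy ||D k||^2 <= e k, so the sum of
   4^k |D k|^2 is integrable, hence finite almost everywhere, and there |D k| is
   O(2^-k). *)
pose e k : R := (4 ^+ k * 2 ^+ k.+1)^-1.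
have e0 k : 0 < e k by rewrite invr_gt0 mulr_gt0// exprn_gt0.
have /choice[N HN] : forall k, exists N, forall m n, (N <= m)%N -> (N <= n)%N ->
    nrm2 (fun x => F m x - F n x) <= e k by move=> k; exact: cauF.
pose phi k := (\sum_(i < k.+1) N i)%N.
have Nphi k j : (k <= j)%N -> (N k <= phi j)%N.
  move=> kj; have kj' : (k < j.+1)%N by [].
  by rewrite /phi (bigD1 (Ordinal kj'))//= leq_addr.
pose G k := F (phi k); have LG k : L2 (G k) by exact: LF.
pose D k x := G k.+1 x - G k x.
have LD k : L2 (D k) by exact: L2B.
have nD k : nrm2 (D k) <= e k by apply: HN; apply: Nphi.
pose S x := (\sum_(k <oo) (4 ^+ k * cabs (D k x) ^+ 2)%:E)%E.
have t0 k x : (0 <= (4 ^+ k * cabs (D k x) ^+ 2)%:E)%E.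
  by rewrite lee_fin mulr_ge0 ?sqr_ge0 ?exprn_ge0.
have mt k : measurable_fun setT (fun x => (4 ^+ k * cabs (D k x) ^+ 2)%:E).
  apply/measurable_EFinP; apply: measurable_funM => //.
  by apply: measurable_sqr_cabs; case: (LD k).
have S0 x : (0 <= S x)%E by exact: nneseries_ge0.
have mS : measurable_fun setT S.
  apply: (@ge0_emeasurable_sum _ _ _ _ _ predT) => //.
have iS : mu.-integrable setT S.
  apply/integrableP; split => //.
  under eq_integral do rewrite gee0_abs//.
  rewrite integral_nneseries//.
  apply: (@le_lt_trans _ _ (\sum_(k <oo) (1 / (2 ^ (k + 1))%:R)%:E)%E).
    apply: lee_nneseries => k _; first by move=> _; exact: integral_ge0.
    rewrite (_ : (fun x => _) = (fun x => (4 ^+ k)%:E * (cabs (D k x) ^+ 2)%:E)%E)//.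
    rewrite ge0_integralZl_EFin ?exprn_ge0//; last 2 first.
      by move=> x _; rewrite lee_fin sqr_ge0.
      by apply: measurable_sqr_cabs_EFin; case: (LD k).
    rewrite -/(sqnorm2 (D k)) sqnorm2E// -EFinM lee_fin.
    apply: le_trans (_ : 4 ^+ k * e k <= _).
      by rewrite ler_wpM2l// exprn_ge0.
    by rewrite /e invfM mulrA divff ?expf_neq0// addn1 natrX.
  by have /cvg_lim -> // := @cvg_geometric_eseries_half R 1 0; rewrite ltry.
pose E := [set x | S x \is a fin_num].
have mE : measurable E.
  by have := emeasurable_fin_num measurableT mS; rewrite setTI.
have aeE : {ae mu, forall x, E x}.
  by apply: aeS (integrable_ae measurableT iS) => x; exact.
have DE x k : E x -> cabs (D k x) <= Num.sqrt (fine (S x)) * 2^-1 ^+ k.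
  move=> Ex; rewrite -ler_sqr ?nnegrE ?cabs_ge0 ?mulr_ge0 ?sqrtr_ge0 ?exprn_ge0//.
  rewrite exprMn sqr_sqrtr ?fine_ge0//.
  rewrite exprAC !exprVn (_ : 2 ^+ 2 = 4)//; last by rewrite -natrX.
  rewrite ler_pdivlMr ?exprn_gt0// mulrC -lee_fin fineK//.
  apply: le_trans (nneseries_lim_ge k.+1 _) => //.
  by rewrite big_mkord big_ord_recr/= leeDr// sume_ge0.
(* Off the set E of full measure the sequence is replaced by 0, so that it converges at every point
   and its limit is measurable. *)
pose H k x := (\1_E x)%:C * G k x.
have LH k : L2 (H k) by exact: L2_indic.
have cH x : cvgn (fun k => complex.Re (H k x)) /\
            cvgn (fun k => complex.Im (H k x)).
  pose C := \1_E x * Num.sqrt (fine (S x)).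
  have C0 : 0 <= C by rewrite mulr_ge0// ?sqrtr_ge0// indicE.
  have HC k : cabs (H k.+1 x - H k x) <= C * 2^-1 ^+ k.
    rewrite /H -mulrBr cabsM cabs_real -mulrA indicE.
    have [/set_mem/DE Dk|_] := boolP (x \in E); last by rewrite normr0 !mul0r.
    by rewrite normr1 !mul1r; exact: Dk.
  split; apply: (geometric_increments_cvg C0) => k; apply: le_trans (HC k).
  - by rewrite -cReN -cReD normr_Re_le.
  - by rewrite -cImN -cImD normr_Im_le.
pose g : R -> R[i] := fun x =>
  limn (fun k => complex.Re (H k x)) +i* limn (fun k => complex.Im (H k x)).
have rH x : complex.Re (H k x) @[k --> \oo] --> complex.Re (g x) by case: (cH x).
have iH x : complex.Im (H k x) @[k --> \oo] --> complex.Im (g x) by case: (cH x).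
have mg : cmeasurable g.
  by apply: (@cmeasurable_cvg H g) => [n| |]; [exact: L2_cmeasurable|exact: rH|exact: iH].
(* By Fatou, the bound on the distance from [F m] to the subsequence survives the pointwise limit.
   As m is arbitrary beyond [N k], the whole sequence converges. *)
have key k m : (N k <= m)%N ->
    (sqnorm2 (fun x => g x - (\1_E x)%:C * F m x)%R <= (e k)%:E)%E.
  move=> km; apply: (@fatou_sqnorm2 (fun j x => H (j + k)%N x - (\1_E x)%:C * F m x)).
  - by move=> n; apply: L2_cmeasurable; apply: L2B => //; exact: L2_indic.
  - move=> x; under eq_fun do rewrite cReD.
    rewrite cReD; apply: cvgD; last exact: cvg_cst.
    by rewrite (cvg_shiftn k (fun j => complex.Re (H j x))).
  - move=> x; under eq_fun do rewrite cImD.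
    rewrite cImD; apply: cvgD; last exact: cvg_cst.
    by rewrite (cvg_shiftn k (fun j => complex.Im (H j x))).
  - move=> j; under [X in sqnorm2 X]eq_fun do rewrite -mulrBr.
    apply: (@le_trans _ _ (sqnorm2 (fun x => G (j + k)%N x - F m x))).
      apply: ge0_le_integral => //.
      + by move=> x _; rewrite lee_fin sqr_ge0.
      + by apply: measurable_sqr_cabs_EFin; apply: L2_cmeasurable;
          apply: L2_indic => //; exact: L2B.
      + by apply: measurable_sqr_cabs_EFin; apply: L2_cmeasurable; exact: L2B.
      + move=> x _; rewrite lee_fin cabsM exprMn ler_piMl ?sqr_ge0//.
        by rewrite expr_le1 ?cabs_ge0// cabs_indic.
    rewrite sqnorm2E; last exact: L2B.
    by rewrite lee_fin; apply: HN => //; apply: Nphi; rewrite leq_addl.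
have Lg : L2 g.
  have -> : g = (fun x => (g x - (\1_E x)%:C * F (N 0%N) x) + (\1_E x)%:C * F (N 0%N) x).
    by apply/funext => x; rewrite subrK.
  apply: L2D; last exact: L2_indic.
  split; first by apply: cmeasurableB => //; apply: L2_cmeasurable; exact: L2_indic.
  by apply: le_lt_trans (key 0%N _ (leqnn _)) _; rewrite ltry.
exists g => //.
have nrmE m : nrm2 (fun x => F m x - g x) = nrm2 (fun x => g x - (\1_E x)%:C * F m x).
  rewrite nrm2BC /nrm2; congr fine; apply: ae_eq_sqnorm2.
  - by apply: L2_cmeasurable; exact: L2B.
  - by apply: L2_cmeasurable; apply: L2B => //; exact: L2_indic.
  - by apply: aeS aeE => x Ex; rewrite indicE mem_set// mul1r.
apply/cvgrPdist_le => eps eps0.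
have [k ek] : exists k, e k <= eps.
  near \oo => k; exists k.
  apply: (@le_trans _ _ (1 * 2^-1 ^+ k)).
    rewrite mul1r /e exprVn lef_pV2 ?posrE ?mulr_gt0 ?exprn_gt0//.
    rewrite exprS mulrA ler_peMl ?exprn_ge0// -[leLHS]mulr1.
    by rewrite ler_pM ?exprn_ege1//; lra.
  near: k; have h1 : `|2^-1 : R| < 1 by rewrite ger0_norm// invf_lt1// ltr1n.
  have /cvgrPdist_le/(_ _ eps0) := @cvg_geometric R 1 2^-1 h1.
  by apply: filterS => k; rewrite sub0r normrN; apply: le_trans; exact: ler_norm.
near=> m.
rewrite sub0r normrN ger0_norm ?nrm2_ge0// nrmE.
apply: le_trans ek; rewrite -lee_fin -sqnorm2E.
  by apply: key; near: m; exact: nbhs_infty_ge.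
by apply: L2B => //; exact: L2_indic.
Unshelve. all: end_near. Qed.

End riesz_fischer.

(** * Parseval's identity for an orthonormal basis *)

Section orthonormal_basis.
Context {R : realType}.
Notation mu := (@lebesgue_measure R).
Variables (D : set R) (e : nat -> R -> R[i]).
Hypothesis mD : measurable D.
Hypothesis L2e : forall n, L2 (e n).
Hypothesis eD : forall n x, ~ D x -> e n x = 0.
Hypothesis orthonormal_e : forall m n, inner2 (e m) (e n) = (m == n)%:R.
Hypothesis complete_e : forall h : R -> R[i], L2 h ->
  (forall x, ~ D x -> h x = 0) -> (forall n, inner2 h (e n) = 0) -> ae_zero h.

Section expansion.
Variable f : R -> R[i].
Hypothesis Lf : L2 f.

Let c n := inner2 f (e n).
Let P n (x : R) := \sum_(i < n) c i * e i x.
Let a n := \sum_(i < n) cabs (c i) ^+ 2.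

Let L2P n : L2 (P n).
Proof. by apply: L2_sum => i; exact: L2Z. Qed.

Let PS n : P n.+1 = (fun x => P n x + c n * e n x).
Proof. by apply/funext => x; rewrite /P big_ord_recr. Qed.

Let inner2P n m : inner2 (P n) (e m) = if (m < n)%N then c m else 0.
Proof.
elim: n => [|n IH].
  rewrite ltn0 /P (_ : inner2 _ _ = inner2 (fun x => 0 * e 0%N x) (e m)).
    by rewrite inner2Z// mul0r.
  by congr inner2; apply/funext => x; rewrite big_ord0 mul0r.
rewrite PS inner2D//; last exact: L2Z.
rewrite IH inner2Z// orthonormal_e ltnS [(m <= n)%N]leq_eqVlt (eq_sym n).
have [->|mn] := eqVneq m n; first by rewrite ltnn add0r mulr1.
by rewrite mulr0 addr0.
Qed.

Let residual_orth n m : (m < n)%N -> inner2 (fun x => f x - P n x) (e m) = 0.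
Proof. by move=> mn; rewrite inner2B// inner2P mn subrr. Qed.

Let orthP n (h : R -> R[i]) : L2 h -> (forall i, (i < n)%N -> inner2 h (e i) = 0) ->
  inner2 h (P n) = 0.
Proof.
move=> Lh; elim: n => [|n IH] H.
  rewrite (_ : P 0%N = (fun x => 0 * h x)); first by rewrite inner2Zr// conjc0 mul0r.
  by apply/funext => x; rewrite /P big_ord0 mul0r.
rewrite PS inner2Dr//; last exact: L2Z.
by rewrite inner2Zr// H// mulr0 addr0 IH// => i /ltnW; exact: H.
Qed.

(** Pythagoras: the residual is orthogonal to the partial sum, whose squared norm is [a n]. *)
Let nrm2_residual n : nrm2 (fun x => f x - P n x) = nrm2 f - a n.
Proof.
have -> : nrm2 (fun x => f x - P n x) = nrm2 f - nrm2 (P n).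
  have Lr : L2 (fun x => f x - P n x) by exact: L2B.
  have := nrm2D Lr (L2P n).
  rewrite orthP//; last by move=> i ni; exact: residual_orth.
  have -> : (fun x => f x - P n x + P n x) = f by apply/funext => x; rewrite subrK.
  by rewrite /= mulr0 addr0 => ->; rewrite addrK.
congr (_ - _); rewrite /a; elim: n => [|n IH].
  by rewrite big_ord0; apply: nrm2_eq0 => //; apply: ae_true => x; rewrite /P big_ord0.
rewrite PS nrm2D//; last exact: L2Z.
rewrite inner2Zr// inner2P ltnn mulr0/= mulr0 addr0 nrm2Z// IH.
by rewrite nrm2E orthonormal_e eqxx mulr1 big_ord_recr.
Qed.

Let a_le n : a n <= nrm2 f.
Proof. by have := nrm2_ge0 (fun x => f x - P n x); rewrite nrm2_residual subr_ge0. Qed.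

Let nd_a : nondecreasing_seq a.
Proof.
apply/nondecreasing_seqP => n.
by rewrite /a big_ord_recr/= lerDl sqr_ge0.
Qed.

Let nrm2_increment n m : (n <= m)%N ->
  nrm2 (fun x => P m x - P n x) = a m - a n.
Proof.
move=> nm; have Lr : L2 (fun x => f x - P m x) by exact: L2B.
have Lmn : L2 (fun x => P m x - P n x) by exact: L2B.
have := nrm2D Lr Lmn; rewrite inner2Br// !orthP//.
- have -> : (fun x => f x - P m x + (P m x - P n x)) = (fun x => f x - P n x).
    by apply/funext => x; rewrite addrA subrK.
  rewrite !nrm2_residual subrr /= mulr0 addr0; lra.
- by move=> i ni; apply: residual_orth; exact: leq_trans nm.
- by move=> i ni; exact: residual_orth.
Qed.

Let cvg_a : cvgn a.
Proof.
by apply: nondecreasing_is_cvgn => //; exists (nrm2 f) => _ [n _ <-].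
Qed.

(** The increments of the partial sums are those of the bounded monotone sequence [a], so the
    partial sums have an L^2 limit g. What f and g differ by is orthogonal to the whole system,
    hence null by completeness. Completeness speaks of functions that vanish off D, so g is first
    cut off to D, which can only bring it closer to the partial sums. *)
Let residual_cvg0 : (forall x, ~ D x -> f x = 0) ->
  nrm2 (fun x => f x - P n x) @[n --> \oo] --> 0.
Proof.
move=> fD; have [|g Lg gP] := @riesz_fischer R P L2P.
  move=> eps eps0; have /cauchy_cvgP/cauchy_ballP/(_ _ eps0)[[A B]/=] := cvg_a.
  move=> [[N1 _ N1A] [N2 _ N2B]] AB.
  exists (maxn N1 N2) => m n; rewrite !geq_max => /andP[m1 m2] /andP[n1 n2].
  have : ball (a m) eps (a n) by apply: (AB (a m, a n)); split; [exact: N1A|exact: N2B].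
  rewrite /ball/= => H.
  have [mn|/ltnW nm] := leqP m n.
  - rewrite nrm2BC nrm2_increment//; move: H; rewrite distrC => H.
    exact: le_trans (ler_norm _) (ltW H).
  - rewrite nrm2_increment//; exact: le_trans (ler_norm _) (ltW H).
pose h x := f x - (\1_D x)%:C * g x.
have LDg : L2 (fun x => (\1_D x)%:C * g x) by exact: L2_indic.
have Lh : L2 h by exact: L2B.
have PDg n : nrm2 (fun x => P n x - (\1_D x)%:C * g x) <= nrm2 (fun x => P n x - g x).
  rewrite (_ : (fun x => _) = (fun x => (\1_D x)%:C * (P n x - g x))); last first.
    apply/funext => x; rewrite mulrBr; congr (_ - _); rewrite indicE.
    have [xD|/negP xD] := boolP (x \in D); first by rewrite mul1r.
    rewrite mul0r /P big1// => i _.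
    by rewrite eD ?mulr0// => Dx; apply: xD; exact: mem_set.
  have LPg := L2B (L2P n) Lg.
  rewrite -lee_fin -!sqnorm2E//; last exact: L2_indic.
  apply: ge0_le_integral => //.
  - by move=> x _; rewrite lee_fin sqr_ge0.
  - by apply: measurable_sqr_cabs_EFin; apply: L2_cmeasurable; exact: L2_indic.
  - by apply: measurable_sqr_cabs_EFin; exact: L2_cmeasurable.
  - move=> x _; rewrite lee_fin cabsM exprMn ler_piMl ?sqr_ge0//.
    by rewrite expr_le1 ?cabs_ge0// cabs_indic.
have PDg0 : nrm2 (fun x => P n x - (\1_D x)%:C * g x) @[n --> \oo] --> 0.
  apply: (squeeze_cvgr _ (cvg_cst 0) gP).
  by apply: nearW => n; rewrite nrm2_ge0 PDg.
have h0 : ae_zero h.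
  apply: complete_e => // [x nDx|m].
    by rewrite /h fD// indicE memNset// mul0r subr0.
  apply: cabs_eq0; apply/eqP; rewrite -sqrf_eq0 eq_le sqr_ge0 andbT.
  (* Once n exceeds m, the residual f - P n is orthogonal to e m, so <h, e m> depends only on P n -
     1_D g, whose norm tends to 0. *)
  have hm n : (m < n)%N -> cabs (inner2 h (e m)) ^+ 2 <=
      nrm2 (fun x => P n x - (\1_D x)%:C * g x).
    move=> mn; have -> : inner2 h (e m) =
        inner2 (fun x => P n x - (\1_D x)%:C * g x) (e m).
      have -> : h = (fun x => (f x - P n x) + (P n x - (\1_D x)%:C * g x)).
        by apply/funext => x; rewrite addrA subrK.
      by rewrite inner2D ?residual_orth// ?add0r//; exact: L2B.
    apply: le_trans (cauchy_schwarz _ (L2e m)) _; first exact: L2B.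
    by rewrite (nrm2E (e m)) orthonormal_e eqxx mulr1.
  rewrite -(cvg_lim _ PDg0)//; apply: limr_ge; first exact: cvgP PDg0.
  by exists m.+1 => // n /=; exact: hm.
apply: (squeeze_cvgr _ (cvg_cst 0)
  (_ : 2 * nrm2 (fun x => P n x - (\1_D x)%:C * g x) @[n --> \oo] --> 0)).
  apply: nearW => n; rewrite nrm2_ge0/=.
  apply: le_trans (nrm2B_le Lf LDg (L2P n)) _.
  by rewrite (nrm2_eq0 Lh h0) add0r nrm2BC.
by rewrite -[X in _ --> X](mulr0 2); apply: cvgM => //; exact: cvg_cst.
Qed.

Theorem parseval : (forall x, ~ D x -> f x = 0) ->
  (\sum_(n <oo) (cabs (inner2 f (e n)) ^+ 2)%:E)%E = sqnorm2 f.
Proof.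
move=> fD; rewrite sqnorm2E//; apply/cvg_lim => //.
apply: cvg_EFin; first by apply: nearW => n; rewrite sumEFin.
have -> : fine \o (fun n => (\sum_(0 <= i < n) (cabs (inner2 f (e i)) ^+ 2)%:E)%E) =
    (fun n => nrm2 f - nrm2 (fun x => f x - P n x)).
  apply/funext => n; rewrite nrm2_residual /= sumEFin /= big_mkord.
  by rewrite opprB addrC subrK.
rewrite -[X in _ --> X]subr0; apply: cvgB; first exact: cvg_cst.
exact: residual_cvg0.
Qed.

End expansion.
End orthonormal_basis.

(** * Completeness of the exponentials on a period *)

Section sharpening.
Context {R : realType}.

Lemma bernoulli_ineq (y : R) (m : nat) : 0 <= 1 + y -> 1 + m%:R * y <= (1 + y) ^+ m.
Proof.
move=> y0; elim: m => [|m IH]; first by rewrite mul0r addr0 expr0.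
rewrite exprS; apply: (le_trans _ (ler_wpM2l y0 IH)).
rewrite -natr1; have : 0 <= m%:R * y ^+ 2 by rewrite mulr_ge0 ?sqr_ge0.
nra.
Qed.

Lemma cvg_geometric0 (s : R) : 0 <= s < 1 -> s ^+ k @[k --> \oo] --> 0.
Proof.
move=> /andP[s0 s1]; have := @cvg_geometric R 1 s; rewrite ger0_norm// => /(_ s1).
rewrite (_ : geometric 1 s = (fun k => s ^+ k))//.
by apply/funext => k; rewrite /geometric/= mul1r.
Qed.

(** With s the square root of r, split r^k as s^k s^k: one factor keeps k s^k below 1 / (1 - s), the
    other tends to 0. *)
Lemma cvg_arith_geometric (r : R) : 0 <= r < 1 -> k%:R * r ^+ k @[k --> \oo] --> 0.
Proof.
move=> /andP[r0 r1].
pose s := Num.sqrt r.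
have s0 : 0 <= s by rewrite sqrtr_ge0.
have sr : s ^+ 2 = r by rewrite sqr_sqrtr.
have s1 : s < 1.
  by rewrite -(@ltr_pXn2r _ 2) ?nnegrE// sr expr1n.
have h k : k%:R * (1 - s) * s ^+ k <= 1.
  elim: k => [|k IH]; first by rewrite !mul0r.
  rewrite exprS -natr1.
  have sk0 : 0 <= s ^+ k by rewrite exprn_ge0.
  have sk1 : s * s ^+ k <= 1 by rewrite -exprS exprn_ile1// ltW.
  have h1 : k%:R * (1 - s) * s ^+ k * s <= 1 * s by rewrite ler_wpM2r.
  have h2 : (1 - s) * (s * s ^+ k) <= (1 - s) * 1 by rewrite ler_wpM2l// subr_ge0 ltW.
  lra.
have lim0 : (1 - s)^-1 * s ^+ k @[k --> \oo] --> 0.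
  rewrite -[X in _ --> X](mulr0 (1 - s)^-1); apply: cvgM; first exact: cvg_cst.
  by apply: cvg_geometric0; rewrite s0.
apply: (squeeze_cvgr _ (cvg_cst 0) lim0).
apply: nearW => k; rewrite mulr_ge0 ?exprn_ge0//=.
rewrite -sr -exprM mulnC exprM expr2 mulrA ler_wpM2r ?exprn_ge0//.
by rewrite -[leRHS]mul1r ler_pdivlMr ?subr_gt0// mulrAC h.
Qed.

(* With m = k 2^k, m v^k = k (2v)^k tends to 0 or to +oo according to whether
   v < 1/2 or not, and 1 - m v^k <= (1 - v^k)^m <= 1 / (1 + m v^k). *)
Lemma cvg_threshold (v : R) : 0 <= v <= 1 ->
  (1 - v ^+ k) ^+ (k * 2 ^ k) @[k --> \oo] --> ((v < 2^-1)%R%:R : R).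
Proof.
move=> /andP[v0 v1].
have vk0 k : 0 <= v ^+ k by rewrite exprn_ge0.
have vk1 k : v ^+ k <= 1 by rewrite exprn_ile1.
have mE k : (k * 2 ^ k)%:R * v ^+ k = k%:R * (2 * v) ^+ k.
  by rewrite natrM natrX exprMn mulrA.
have [v2|v2] := ltP v 2^-1; rewrite /= ?mulr1n ?mulr0n.
- have lim1 : 1 - k%:R * (2 * v) ^+ k @[k --> \oo] --> (1 : R).
    rewrite -[X in _ --> X]subr0; apply: cvgB; first exact: cvg_cst.
    by apply: cvg_arith_geometric; apply/andP; split; lra.
  apply: (squeeze_cvgr _ lim1 (cvg_cst (1 : R))).
  apply: nearW => k; apply/andP; split; last first.
    by rewrite exprn_ile1 ?subr_ge0// gerBl.
  rewrite -mE -mulrN; apply: bernoulli_ineq.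
  by rewrite subr_ge0.
(* Here 2 v >= 1, so 1 + k (2 v)^k >= k + 1 and the power is at most 1 / (k + 1). *)
- have lim0 : (harmonic k : R) @[k --> \oo] --> 0 by exact: cvg_harmonic.
  apply: (squeeze_cvgr _ (cvg_cst 0) lim0).
  apply: nearW => k; rewrite exprn_ge0 ?subr_ge0//=.
  rewrite -[leRHS]mul1r ler_pdivlMr ?ltr0n//.
  apply: (@le_trans _ _ ((1 - v ^+ k) ^+ (k * 2 ^ k) * (1 + v ^+ k) ^+ (k * 2 ^ k))).
    rewrite ler_wpM2l ?exprn_ge0 ?subr_ge0//.
    apply: le_trans (bernoulli_ineq _ _); last by rewrite addr_ge0.
    rewrite mE -natr1 addrC lerD2l -[leLHS]mulr1 ler_wpM2l// exprn_ege1//; lra.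
  rewrite -exprMn exprn_ile1//.
    by rewrite mulr_ge0 ?subr_ge0// addr_ge0.
  have := sqr_ge0 (v ^+ k); nra.
Qed.

End sharpening.

Section annihilator.
Context {R : realType}.
Notation mu := (@lebesgue_measure R).
Implicit Types (f g : R -> R[i]).
Variable T : R.
Hypothesis T0 : 0 < T.

(** The coefficients are integrals over the whole line, so no period is singled out; f is confined
    to one only when it has to be shown null. *)
Definition coef_vanish f := cintegrable f /\
  forall n : int, cintegral setT (fun x => expi (n%:~R * x / T) * f x) = 0.

(* Contains the exponentials and is closed under sums and products, hence contains
   all trigonometric polynomials without naming them. *)
Definition coef_mult (t : R -> R[i]) := [/\ cmeasurable t,
  exists M, forall x, cabs (t x) <= M &
  forall f, coef_vanish f -> coef_vanish (fun x => t x * f x)].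

Lemma measurable_lin (n : int) : measurable_fun setT (fun x : R => n%:~R * x / T).
Proof. by apply: measurable_funM => //; exact: measurable_funM. Qed.

(** Multiplication by an exponential merely shifts the index of the coefficients. *)
Lemma coef_mult_expi (n : int) : coef_mult (fun x => expi (n%:~R * x / T)).
Proof.
split; first exact: cmeasurable_expi (measurable_lin n).
  by exists 1 => x; rewrite cabs_expi.
move=> f [fi f0]; split.
  apply: (cintegrableMbdd (M := 1)) => //; first exact: cmeasurable_expi (measurable_lin n).
  by move=> x; rewrite cabs_expi.
move=> m; rewrite -[RHS](f0 (m + n)); apply: eq_cintegral => x.
by rewrite mulrA -expiD intrD !mulrDl.
Qed.

Lemma coef_multD s t : coef_mult s -> coef_mult t -> coef_mult (fun x => s x + t x).
Proof.
move=> [ms [M sM] sf] [mt [N tN] tf]; split; first exact: cmeasurableD.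
  by exists (M + N) => x; rewrite (le_trans (le_cabsD _ _))// lerD.
move=> f /[dup] /sf [si s0] /tf [ti t0]; split.
  by under eq_fun do rewrite mulrDl; exact: cintegrableD.
have ie (n : int) h : cintegrable h -> cintegrable (fun x => expi (n%:~R * x / T) * h x).
  apply: (cintegrableMbdd (M := 1)); first exact: cmeasurable_expi (measurable_lin n).
  by move=> x; rewrite cabs_expi.
move=> n; rewrite -[RHS]addr0 -{1}(s0 n) -(t0 n) -cintegralD; [|exact: ie..].
by apply: eq_cintegral => x; rewrite mulrDl mulrDr.
Qed.

Lemma coef_multM s t : coef_mult s -> coef_mult t -> coef_mult (fun x => s x * t x).
Proof.
move=> [ms [M sM] sf] [mt [N tN] tf]; split; first exact: cmeasurableM.
  exists (M * N) => x; rewrite cabsM ler_pM ?cabs_ge0//.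
by move=> f /tf /sf; under eq_fun do rewrite mulrA.
Qed.

Lemma coef_mult_cst z : coef_mult (fun=> z).
Proof.
split; first exact: cmeasurable_cst; first by exists (cabs z).
move=> f [fi f0]; split; first exact: cintegrableZ.
move=> n; under eq_fun do rewrite mulrCA.
rewrite cintegralZ ?f0 ?mulr0//.
apply: (cintegrableMbdd (M := 1)) => //; first exact: cmeasurable_expi (measurable_lin n).
by move=> x; rewrite cabs_expi.
Qed.

Lemma coef_multX t (n : nat) : coef_mult t -> coef_mult (fun x => t x ^+ n).
Proof.
move=> mt; elim: n => [|n IH]; first exact: coef_mult_cst.
by under eq_fun do rewrite exprS; exact: coef_multM.
Qed.

Lemma coef_multB s t : coef_mult s -> coef_mult t -> coef_mult (fun x => s x - t x).
Proof.
move=> ms mt; under eq_fun do rewrite -mulN1r.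
by apply: coef_multD => //; apply: coef_multM => //; exact: coef_mult_cst.
Qed.

Lemma cintegral_indic_cvg f (t : nat -> R -> R) (A : set R) :
  cintegrable f -> measurable A -> (forall k, measurable_fun setT (t k)) ->
  (forall k x, 0 <= t k x <= 1) -> (forall x, t k x @[k --> \oo] --> (\1_A x : R)) ->
  (forall k, cintegral setT (fun x => (t k x)%:C * f x) = 0) ->
  cintegral setT (fun x => (\1_A x)%:C * f x) = 0.
Proof.
move=> [fr fi] mA mt t01 tA tf0.
have dct (g : R -> R) : mu.-integrable setT (EFin \o g) ->
    (forall k, \int[mu]_x (t k x * g x) = 0) -> \int[mu]_x (\1_A x * g x) = 0.
  move=> ig g0; have mg : measurable_fun setT g.
    by apply/measurable_EFinP; exact: measurable_int ig.
  have [|||||i1 _] := @dominated_convergence _ _ R mu setT measurableT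
    (fun k x => (t k x * g x)%:E) (fun x => (\1_A x * g x)%:E) (fun x => `|g x|%:E).
  - by move=> k; apply/measurable_EFinP; apply: measurable_funM => //; exact: mt.
  - by apply/measurable_EFinP; apply: measurable_funM => //; exact: measurable_indic.
  - apply: ae_true => x _; apply: cvg_EFin; first exact: nearW.
    by apply: cvgM => //; exact: cvg_cst.
  - exact: integrable_norm.
  - apply: ae_true => x n _; rewrite lee_fin normrM ler_piMl//.
    by have /andP[? ?] := t01 n x; rewrite ger0_norm.
  rewrite (_ : [sequence _]_n = fun=> 0%E).
    by move=> /(cvg_unique (@ereal_hausdorff R)) /(_ (cvg_cst _)) => H;
      rewrite /Rintegral H.
  apply/funext => k /=; have := g0 k; rewrite /Rintegral => H.
  rewrite -[LHS]fineK ?H//; apply: integrable_fin_num => //.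
  apply: (le_integrable _ _ _ ig) => //.
    by apply/measurable_EFinP; apply: measurable_funM => //; exact: mt.
  move=> x _; rewrite lee_fin normrM ler_piMl//.
  by have /andP[? ?] := t01 k x; rewrite ger0_norm.
apply: eq_ReIm => /=.
- under eq_Rintegral do rewrite cReM/= mul0r subr0.
  apply: dct => // k; have := congr1 (@complex.Re R) (tf0 k); rewrite /= => H.
  by rewrite -[RHS]H; apply: eq_Rintegral => x _; rewrite cReM/= mul0r subr0.
- under eq_Rintegral do rewrite cImM/= mul0r addr0.
  apply: dct => // k; have := congr1 (@complex.Im R) (tf0 k); rewrite /= => H.
  by rewrite -[RHS]H; apply: eq_Rintegral => x _; rewrite cImM/= mul0r addr0.
Qed.

(** The powers in [cvg_threshold], taken at a trigonometric polynomial v with values in [0, 1] that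
    is below 1/2 exactly on the arc, are multipliers which integrate to 0 against f; dominated
    convergence passes to the indicator. *)
Lemma coef_vanish_arc f (x0 c : R) : -1 <= c <= 1 -> coef_vanish f ->
  cintegral setT (fun x => (\1_[set x | c < cos (2 * pi * ((x - x0) / T))] x)%:C * f x) = 0.
Proof.
(* The cosine minus c lies in [-2, 2], so dividing by 4 puts v in [0, 1]. *)
move=> c1 fv; pose v x : R := 2^-1 - (cos (2 * pi * ((x - x0) / T)) - c) / 4.
have v01 x : 0 <= v x <= 1.
  have := cos_le1 (2 * pi * ((x - x0) / T)); have := cos_geN1 (2 * pi * ((x - x0) / T)).
  by rewrite /v; lra.
have mv : measurable_fun setT v.
  apply: measurable_funB => //; apply: measurable_funM => //; apply: measurable_funB => //.
  apply: (measurableT_comp (f := @cos R)).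
    exact: continuous_measurable_fun (@continuous_cos R).
  apply: measurable_funM => //; apply: measurable_funM => //.
  exact: measurable_funB.
have multv : coef_mult (fun x => (v x)%:C).
  (* The cosine is half the sum of two conjugate exponentials; with the factor 1/4 this yields the
     coefficients 1/8. *)
  rewrite (_ : (fun x => _) = (fun x => (2^-1 + c / 4)%:C +
     ((- 8^-1)%:C * expi (- x0 / T)) * expi (1%:~R * x / T) +
     ((- 8^-1)%:C * expi (x0 / T)) * expi ((-1)%:~R * x / T))).
    have me n z : coef_mult (fun x => z * expi (n%:~R * x / T)).
      by apply: coef_multM; [exact: coef_mult_cst|exact: coef_mult_expi].
    by apply: coef_multD => //; apply: coef_multD => //; exact: coef_mult_cst.
  apply/funext => x; rewrite -!mulrA -!expiD.
  rewrite (_ : - x0 / T + _ = (x - x0) / T); last by ring.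
  rewrite (_ : x0 / T + _ = - ((x - x0) / T)); last by ring.
  apply: eq_ReIm; rewrite /= ?mulrN ?cosN ?sinN /v; first by field.
  by ring.
pose t k x := (1 - v x ^+ k) ^+ (k * 2 ^ k).
have multt k : coef_mult (fun x => (t k x)%:C).
  under eq_fun do rewrite /t rmorphXn rmorphB rmorph1 rmorphXn.
  by apply: coef_multX; apply: coef_multB; [exact: coef_mult_cst|exact: coef_multX].
apply: (@cintegral_indic_cvg _ t).
- by case: fv.
- rewrite -[X in measurable X]setTI.
  rewrite (_ : [set x | _] = v @^-1` `]-oo, 2^-1[%classic).
    exact: (mv measurableT).
  by apply/seteqP; split => x /=; rewrite in_itv/= /v => ?; lra.
- by move=> k; apply: measurable_funX; apply: measurable_funB => //; exact: measurable_funX.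
- move=> k x; have /andP[v0 v1] := v01 x.
  have vk0 : 0 <= v x ^+ k by rewrite exprn_ge0.
  have vk1 : v x ^+ k <= 1 by rewrite exprn_ile1.
  by rewrite exprn_ge0 ?subr_ge0//= exprn_ile1 ?subr_ge0// gerBl.
- move=> x; rewrite indicE.
  rewrite (_ : (_ \in _) = (v x < 2^-1)%R); first exact: cvg_threshold.
  apply/idP/idP => [/set_mem/= H|H]; first by rewrite /v; lra.
  by apply/mem_set => /=; move: H; rewrite /v; lra.
- move=> k; have [_ _ /(_ f fv)[_ /(_ 0)]] := multt k.
  move=> H; rewrite -[RHS]H; apply: eq_cintegral => x.
  by rewrite !mul0r expi0 mul1r.
Qed.

End annihilator.

Section fourier_series_completeness.
Context {R : realType}.
Notation mu := (@lebesgue_measure R).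

(** Over a ball on which g integrates to 0, the average of |g - g x| is at least |g x|; at a
    Lebesgue point these averages tend to 0. *)
Lemma lebesgue_pt_eq0 (g : R -> R) (x : R) :
  mu.-integrable setT (EFin \o g) -> lebesgue_pt g x ->
  (\forall r \near (0 : R)^'+, \int[mu]_(y in ball x r) g y = 0) -> g x = 0.
Proof.
move=> ig gx int0; apply/eqP; rewrite -normr_eq0 eq_le normr_ge0 andbT.
rewrite -lee_fin -[leRHS](cvg_lim _ gx)//; apply: lime_ge; first exact: cvgP gx.
near=> r; have r0 : 0 < r by near: r; exact: nbhs_right_gt.
have mB := measurable_ball x r.
have igB : mu.-integrable (ball x r) (EFin \o g) by exact: integrableS ig.
have muB : mu (ball x r) = (r *+ 2)%:E by rewrite lebesgue_measure_ball// ltW.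
have icB : mu.-integrable (ball x r) (EFin \o cst (g x)).
  have muBoo : (mu (ball x r) < +oo)%E by rewrite muB ltry.
  by apply: measurable_bounded_integrable => //; exact: bounded_cst.
have igc : mu.-integrable (ball x r) (EFin \o (fun y => g y - g x)).
  rewrite (_ : EFin \o _ = (EFin \o g) \- (EFin \o cst (g x)))%E//.
  exact: integrableB.
rewrite /davg /iavg muB inver gt_eqF ?mulrn_wgt0// lee_pdivlMl ?mulrn_wgt0//.
apply: le_trans (le_abse_integral mu mB _); last first.
  apply/measurable_EFinP; apply: measurable_funB => //.
  by apply/measurable_EFinP; exact: measurable_int igB.
rewrite (_ : (\int[_]_(_ in _) _)%E = (\int[mu]_(y in ball x r) (g y - g x) )%:E).
  rewrite RintegralB//.
  have -> : \int[mu]_(y in ball x r) g y = 0 by near: r.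
  rewrite sub0r Rintegral_cst//.
  rewrite (_ : fine _ = r *+ 2); last by rewrite [X in fine X]muB.
  rewrite /= normrN normrM [X in _ * X]ger0_norm ?mulrn_wge0 ?(ltW r0)//.
  by rewrite -EFinM mulrC.
by rewrite /Rintegral fineK//; apply: integrable_fin_num.
Unshelve. all: end_near. Qed.

(** The function cos (w s) exceeds cos (w rho) exactly within rho of a multiple of 2 pi / w. The
    bound on |s| keeps s at distance at least rho from every such multiple except 0. *)
Lemma cos_gt_arc (w rho s : R) : 0 < rho -> 0 < w -> w * rho < pi ->
  `|s| <= 2 * pi / w - rho -> (cos (w * rho) < cos (w * s)) = (`|s| < rho).
Proof.
move=> rho0 w0 wrho sle.
have -> : cos (w * s) = cos (w * `|s|).
  by rewrite -(cos_norm (w * s)) normrM (gtr0_norm w0).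
move: (normr_ge0 s) sle; move: `|s| => {}s s0.
rewrite lerBrDr ler_pdivlMr// => sle.
have [ws|ws] := leP (w * s) pi.
  rewrite ltr_cos ?in_itv/= ?mulr_ge0 ?(ltW wrho) ?ws ?(ltW w0) ?(ltW rho0)//.
  by rewrite ltr_pM2l.
have rhos : rho <= s by rewrite -(ler_pM2l w0) ltW// (lt_trans wrho).
rewrite [RHS]ltNge rhos/=; apply/negbTE; rewrite -leNgt.
(* Past pi the angle is reflected to 2 pi - w s, which lies between w rho and pi, where the cosine
   decreases. *)
rewrite -[cos (w * s)]cosN -(cosD2pi (- (w * s))) leNgt ltr_cos.
- by rewrite -leNgt mulr2n; nra.
- by rewrite in_itv/= mulr2n; apply/andP; split; nra.
- by rewrite in_itv/= mulr_ge0 ?(ltW w0) ?(ltW rho0)//= ltW.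
Qed.

Variables (T a : R).
Hypothesis T0 : 0 < T.

(** Within the period the ball is an arc. Since the ball stays inside the period, every x of the
    period satisfies |x - x0| <= T - rho, which is the condition of [cos_gt_arc]. *)
Lemma coef_vanish_ball (f : R -> R[i]) x0 rho :
  coef_vanish T f -> (forall x, ~ `[a, a + T[%classic x -> f x = 0) ->
  0 < rho -> rho < T / 2 -> a <= x0 - rho -> x0 + rho <= a + T ->
  cintegral (ball x0 rho) f = 0.
Proof.
move=> fv f0 rho0 rhoT ax0 x0a.
have c1 : -1 <= cos (2 * pi / T * rho) <= 1 by rewrite cos_geN1 cos_le1.
rewrite cintegral_mkcond -[RHS](coef_vanish_arc x0 c1 fv).
apply: eq_cintegral => x; rewrite !indicE.
have [xD|/f0 ->] := pselect (`[a, a + T[%classic x); last by rewrite !mulr0.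
congr (_ %:R %:C * _); move: xD; rewrite /= in_itv/= => /andP[ax xa].
have T0' : 0 < 2 * pi / T by rewrite divr_gt0// mulr_gt0// pi_gt0.
have E : (cos (2 * pi / T * rho) < cos (2 * pi * ((x - x0) / T))) = (`|x - x0| < rho).
  rewrite (_ : 2 * pi * ((x - x0) / T) = 2 * pi / T * (x - x0)); last by ring.
  rewrite cos_gt_arc//.
  - rewrite (_ : _ * rho = pi * (2 * rho / T)); last by ring.
    by rewrite gtr_pMr ?pi_gt0// ltr_pdivrMr// mul1r; lra.
  - rewrite invf_div [2 * pi * _]mulrC mulfVK ?gt_eqF ?mulr_gt0 ?pi_gt0//.
    by rewrite ler_norml; apply/andP; split; lra.
congr nat_of_bool; apply/idP/idP => /set_mem/= H; apply/mem_set => /=.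
- by rewrite E distrC.
- by move: H; rewrite E distrC.
Qed.

(** Almost every point is a Lebesgue point of both parts of f and differs from the endpoint a.
    Inside the period all small balls around it have integral 0. *)
Theorem coef_vanish_ae0 (f : R -> R[i]) :
  coef_vanish T f -> (forall x, ~ `[a, a + T[%classic x -> f x = 0) -> ae_zero f.
Proof.
move=> fv f0; have [[fr fi] _] := fv.
have locr := open_integrable_locally openT fr.
have loci := open_integrable_locally openT fi.
have aea : {ae mu, forall x, x != a}.
  exists [set a]; split => //; first exact: lebesgue_measure_set1.
  by move=> x /= /negP; rewrite negbK => /eqP.
have := aeI aea (aeI (lebesgue_differentiation locr) (lebesgue_differentiation loci)).
apply: aeS => x [xa [xr xi]].
have [xD|/f0//] := pselect (`[a, a + T[%classic x).
have {xD xa} [ax xT] : a < x /\ x < a + T.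
  by move: xD; rewrite /= in_itv/= [a < x]lt_neqAle eq_sym xa => /andP[-> ->].
have H : \forall r \near (0 : R)^'+, cintegral (ball x r) f = 0.
  near=> r; apply: coef_vanish_ball => //.
  - by near: r; apply: nbhs_right_lt; rewrite divr_gt0.
  - by rewrite lerBrDr -lerBrDl; near: r; apply: nbhs_right_le; rewrite subr_gt0.
  - by rewrite -lerBrDl; near: r; apply: nbhs_right_le; rewrite subr_gt0.
apply: eq_ReIm.
- by apply: lebesgue_pt_eq0 xr _ => //; apply: filterS H => r /(congr1 (@complex.Re R)).
- by apply: lebesgue_pt_eq0 xi _ => //; apply: filterS H => r /(congr1 (@complex.Im R)).
Unshelve. all: end_near. Qed.

End fourier_series_completeness.

(** * Fourier series *)

Section fourier_series.
Context {R : realType}.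
Notation mu := (@lebesgue_measure R).
Variables (T a : R).
Hypothesis T0 : 0 < T.
Notation D := `[a, a + T[%classic.

Lemma FTC2_bndo (f F : R -> R) (c d : R) : c < d -> continuous f ->
  (forall x : R, is_derive x 1 F (f x)) ->
  \int[mu]_(x in `[c, d[) f x = F d - F c.
Proof.
move=> cd cf dF; rewrite /Rintegral integral_itv_bndo_bndc; last first.
  apply/measurable_EFinP; apply: measurable_funTS.
  exact: continuous_measurable_fun.
have cF : continuous F.
  by move=> x; apply: differentiable_continuous; apply/derivable1_diffP; have [] := dF x.
rewrite (continuous_FTC2 cd _ (F := F)) => //.
- exact: continuous_subspaceT.
- split.
  + by move=> x _; have [] := dF x.
  + by apply: cvg_at_right_filter; exact: cF.
  + by apply: cvg_at_left_filter; exact: cF.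
- by move=> x _; rewrite derive1E; have [] := dF x.
Qed.

Lemma cintegral_expi_period (k : int) :
  cintegral D (fun x => expi (k%:~R * x / T)) = if k == 0 then T%:C else 0.
Proof.
have [->|k0] := eqVneq k 0.
  apply: eq_ReIm => /=.
  - under eq_Rintegral do rewrite !mul0r mulr0 cos0.
    by rewrite Rintegral_cst//= lebesgue_measure_itv/= lte_fin ltrDl T0/= addrAC subrr add0r mul1r.
  - under eq_Rintegral do rewrite !mul0r mulr0 sin0.
    by rewrite Rintegral_cst//= mul0r.
pose w := 2 * pi * k%:~R / T.
have w0 : w != 0.
  apply: mulf_neq0; last by rewrite invr_eq0 gt_eqF.
  by apply: mulf_neq0; rewrite ?intr_eq0// gt_eqF// mulr_gt0// pi_gt0.
have wE x : 2 * pi * (k%:~R * x / T) = w * x by rewrite /w; ring.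
have [cE sE] : cos (w * (a + T)) = cos (w * a) /\ sin (w * (a + T)) = sin (w * a).
  have : expi (k%:~R * (a + T) / T) = expi (k%:~R * a / T) :> R[i].
    by rewrite mulrDr mulrDl mulfK ?gt_eqF// expiD expi_int mulr1.
  by rewrite /expi !wE => -[].
have aT : a < a + T by rewrite ltrDl.
have cw : continuous (fun x : R => w * x) by move=> x; exact: mulrl_continuous.
apply: eq_ReIm => /=.
- under eq_Rintegral do rewrite wE.
  have dF (x : R) : is_derive x (1 : R) (fun x => w^-1 * sin (w * x)) (cos (w * x)).
    apply: is_derive_eq; rewrite ?scaler0 ?addr0.
    by rewrite /GRing.scale/= mulr1 mulrCA mulVf// mulr1.
  rewrite (FTC2_bndo aT _ dF) ?sE ?subrr// => x.
  by apply: continuous_comp; [exact: cw|exact: continuous_cos].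
- under eq_Rintegral do rewrite wE.
  have dF (x : R) : is_derive x (1 : R) (fun x => - (w^-1 * cos (w * x))) (sin (w * x)).
    apply: is_derive_eq; rewrite ?scaler0 ?addr0.
    by rewrite /GRing.scale/= mulr1 mulNr mulrN opprK mulrCA mulVf// mulr1.
  rewrite (FTC2_bndo aT _ dF) ?cE ?subrr// => x.
  by apply: continuous_comp; [exact: cw|exact: continuous_sin].
Qed.

(** Runs through 0, -1, 1, -2, ...; an explicit enumeration, since [parseval] and the exchange of
    series and integrals are indexed by naturals, the sums of the theorem by integers. *)
Definition nat_int (n : nat) : int := if odd n then Negz n./2 else Posz n./2.

Lemma nat_int_bij : set_bij [set: nat] [set: int] nat_int.
Proof.
split => //.
- move=> m n _ _; rewrite /nat_int.
  have := odd_double_half m; have := odd_double_half n.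
  by case: (odd m); case: (odd n) => // nE mE [mn]; rewrite -mE -[RHS]nE mn.
- move=> [m|m] _.
  + by exists m.*2 => //; rewrite /nat_int odd_double doubleK.
  + by exists m.*2.+1 => //; rewrite /nat_int /= odd_double/= uphalf_double.
Qed.

(** The minus sign is undone by the conjugation in [inner2], so that the coefficients agree with
    those of [coef_vanish]. *)
Let e (n : nat) (x : R) : R[i] :=
  (\1_D x * (Num.sqrt T)^-1)%:C * expi (- ((nat_int n)%:~R * x / T)).

(** Such an f is its own product with the indicator of the interval, and both factors are in L^2. *)
Lemma L2_itv_cintegrable (f : R -> R[i]) (c d : R) : L2 f ->
  (forall x, ~ `[c, d]%classic x -> f x = 0) -> cintegrable f.
Proof.
move=> Lf f0; have L1 : L2 (fun x => (\1_`[c, d]%classic x)%:C : R[i]).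
  apply: (@integrable_L2 _ _ (\1_`[c, d]%classic)).
  - exact: cmeasurable_indic.
  - exact: integrable_indic_itv.
  - by move=> x; rewrite cabs_real real_normK ?num_real// indicE -natrX; case: (_ \in _).
have := cintegrable_mul L1 Lf.
rewrite (_ : (fun x => _) = f)//; apply/funext => x.
have [xD|xD] := pselect (`[c, d]%classic x); last by rewrite f0// mulr0.
by rewrite indicE mem_set// mul1r.
Qed.

Let mD : measurable D. Proof. exact: measurable_itv. Qed.

Let mexp (k : int) : cmeasurable (fun x => expi (k%:~R * x / T)).
Proof. exact: cmeasurable_expi (measurable_lin T k). Qed.

Let ci_indic (k : int) : cintegrable (fun x => (\1_D x)%:C * expi (k%:~R * x / T)).
Proof.
apply: (@le_cintegrable _ _ (\1_D : R -> R)).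
- by apply: cmeasurableM; [exact: cmeasurable_indic|exact: mexp].
- apply: integrable_indic_itv.
- by move=> x; rewrite cabsM cabs_expi mulr1 cabs_real ger0_norm.
Qed.

Let L2e n : L2 (e n).
Proof.
apply: (@integrable_L2 _ _ (fun x => (Num.sqrt T)^-1 ^+ 2 * \1_D x)).
- apply: cmeasurableM.
    by apply: cmeasurable_real; apply: measurable_funM => //; exact: measurable_indic.
  under eq_fun do rewrite -conj_expi.
  by apply: cmeasurableJ; exact: mexp.
- apply: (integrableZl measurableT _ (integrable_indic_itv _ _ _ _)).
- move=> x; rewrite cabsM cabs_expi mulr1 cabs_real real_normK ?num_real//.
  by rewrite exprMn mulrC indicE -natrX; case: (_ \in _).
Qed.

Let eD n x : ~ D x -> e n x = 0.
Proof. by move=> nD; rewrite /e indicE memNset// !mul0r. Qed.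

Let inner2e (f : R -> R[i]) n : L2 f -> (forall x, ~ D x -> f x = 0) ->
  inner2 f (e n) = (Num.sqrt T)^-1%:C *
    cintegral setT (fun x => expi ((nat_int n)%:~R * x / T) * f x).
Proof.
move=> Lf fD; rewrite -cintegralZ; last first.
  apply: (cintegrableMbdd (M := 1)) => //.
  - by move=> x; rewrite cabs_expi.
  - apply: (@L2_itv_cintegrable _ a (a + T)) => // x nD; apply: fD.
    by apply: contra_not nD => /=; rewrite !in_itv/= => /andP[-> /ltW ->].
apply: eq_cintegral => x; rewrite /e.
have [xD|/fD ->] := pselect (D x); last by rewrite !mulr0 mul0r.
rewrite indicE mem_set// mul1r cJM conj_expi opprK conjc_real.
by rewrite mulrC mulrA.
Qed.

Let orthonormal_e m n : inner2 (e m) (e n) = (m == n)%:R.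
Proof.
rewrite inner2e//; last exact: eD.
have sT0 : Num.sqrt T != 0 by rewrite gt_eqF ?sqrtr_gt0.
rewrite (_ : cintegral _ _ = (Num.sqrt T)^-1%:C *
    cintegral D (fun x => expi ((nat_int n - nat_int m)%:~R * x / T))); last first.
  rewrite [cintegral D _]cintegral_mkcond -cintegralZ; last exact: ci_indic.
  apply: eq_cintegral => x; rewrite /e intrB !mulrBl expiD rmorphM/=.
  by ring.
rewrite cintegral_expi_period subr_eq0 mulrA -rmorphM/=.
rewrite -expr2 exprVn sqr_sqrtr ?ltW//.
have [<-|mn] := eqVneq m n.
  by rewrite eqxx -rmorphM/= mulVf// gt_eqF.
rewrite (_ : (_ == _) = false) ?mulr0//; apply/negbTE; apply: contra mn => /eqP H.
have [_ inj _] := nat_int_bij.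
by apply/eqP/esym/inj => //; exact: mem_set.
Qed.

Let complete_e (h : R -> R[i]) : L2 h -> (forall x, ~ D x -> h x = 0) ->
  (forall n, inner2 h (e n) = 0) -> ae_zero h.
Proof.
move=> Lh hD h0; apply: (coef_vanish_ae0 T0 _ hD); split.
  apply: (@L2_itv_cintegrable _ a (a + T)) => // x nD; apply: hD.
  by apply: contra_not nD => /=; rewrite !in_itv/= => /andP[-> /ltW ->].
move=> k; have [_ _ /(_ k I)[n _ <-]] := nat_int_bij.
apply/eqP; have /eqP := h0 n; rewrite inner2e// mulf_eq0 => /orP[|//].
by rewrite fmorph_eq0 invr_eq0 sqrtr_eq0 leNgt T0.
Qed.

Theorem fourier_series_parseval (f : R -> R[i]) : L2 f ->
  (forall x, ~ D x -> f x = 0) ->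
  (\esum_(n in [set: int])
    (cabs (cintegral setT (fun x => expi (n%:~R * x / T) * f x)) ^+ 2)%:E =
  T%:E * sqnorm2 f)%E.
Proof.
(* This factor cancels the normalisation 1 / sqrt T of [e]; its square is the T on the right-hand
   side. *)
move=> Lf fD; pose F x := (Num.sqrt T)%:C * f x.
have LF : L2 F by exact: L2Z.
have FD x : ~ D x -> F x = 0 by move=> /fD; rewrite /F => ->; rewrite mulr0.
transitivity (sqnorm2 F); last first.
  rewrite !sqnorm2E// nrm2Z// EFinM cabs_real ger0_norm ?sqrtr_ge0//.
  by rewrite sqr_sqrtr// ltW.
rewrite -(parseval mD L2e eD orthonormal_e complete_e LF FD).
rewrite nneseries_esumT; last by move=> n; rewrite lee_fin sqr_ge0.
rewrite (reindex_esum _ _ _ _ nat_int_bij); apply: eq_esum => n _.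
congr (cabs _ ^+ 2)%:E; rewrite inner2Z// inner2e// mulrA -rmorphM/=.
by rewrite divff ?mul1r// gt_eqF// sqrtr_gt0.
Qed.

End fourier_series.

(** * The Fourier transform on L^2 *)

Section fourier_compact_support.
Context {R : realType}.
Notation mu := (@lebesgue_measure R).

Lemma measurable_integral_param (h : R * R -> \bar R) : measurable_fun setT h ->
  (forall z, (0 <= h z)%E) ->
  measurable_fun [set: R] (fun y : R => \int[mu]_x h (y, x))%E.
Proof.
move=> mh h0.
have := @measurable_fun_fubini_tonelli_F _ _ (measurableTypeR R) (measurableTypeR R) R mu h.
by move=> /(_ mh h0); exact.
Qed.

(** Tonelli's measurability statement is about nonnegative functions, hence the split into positive
    and negative parts. *)
Lemma measurable_Rintegral_param (h : R * R -> R) : measurable_fun setT h ->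
  measurable_fun setT (fun y => \int[mu]_x h (y, x)).
Proof.
move=> mh; have mE : measurable_fun setT (EFin \o h) by exact/measurable_EFinP.
rewrite /Rintegral.
apply: (measurableT_comp (f := @fine R)) => //.
under eq_fun do rewrite integralE.
apply: emeasurable_funB.
- rewrite (_ : (fun _ => _) = fun y => \int[mu]_x (EFin \o h)^\+ (y, x))%E.
    apply: (@measurable_integral_param ((EFin \o h)^\+)%E) => //.
    exact: measurable_funepos.
  by apply/funext => y; apply: eq_integral => x _; rewrite !funeposE.
- rewrite (_ : (fun _ => _) = fun y => \int[mu]_x (EFin \o h)^\- (y, x))%E.
    apply: (@measurable_integral_param ((EFin \o h)^\-)%E) => //.
    exact: measurable_funeneg.
  by apply/funext => y; apply: eq_integral => x _; rewrite !funenegE.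
Qed.

Lemma measurable_kernel (c : R -> R) (p : R * R -> R) (g : R -> R) :
  measurable_fun setT c -> measurable_fun setT p -> measurable_fun setT g ->
  measurable_fun setT (fun z : R * R => g z.2 * c (p z)).
Proof.
move=> mc mp mg; apply: measurable_funM.
- exact: measurableT_comp mg (@measurable_snd _ _ R R).
- exact: measurableT_comp mc mp.
Qed.

Lemma cmeasurable_fourier_on (f : R -> R[i]) : cmeasurable f ->
  cmeasurable (fourier_on setT f).
Proof.
move=> [fr fi].
have mp : measurable_fun [set: R * R] (fun z : R * R => 2 * pi * - (z.2 * z.1)).
  apply: measurable_funM => //; apply: measurable_funN.
  exact: measurable_funM (@measurable_snd _ _ R R) (@measurable_fst _ _ R R).
have mc := continuous_measurable_fun (@continuous_cos R).
have ms := continuous_measurable_fun (@continuous_sin R).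
split; rewrite /fourier_on /cintegral /=.
- apply: (@measurable_Rintegral_param (fun z => complex.Re (f z.2 * expi (- (z.2 * z.1))))).
  under eq_fun do rewrite cReM.
  apply: measurable_funB.
  - exact: (measurable_kernel mc mp fr).
  - exact: (measurable_kernel ms mp fi).
- apply: (@measurable_Rintegral_param (fun z => complex.Im (f z.2 * expi (- (z.2 * z.1))))).
  under eq_fun do rewrite cImM.
  apply: measurable_funD.
  - exact: (measurable_kernel ms mp fr).
  - exact: (measurable_kernel mc mp fi).
Qed.

(** Half-open cells of length h tile the line, the point x lying in the one of index - floor (x /
    h). Each cell is shifted back to [0, h[, and monotone convergence moves the sum inside the
    integral. *)
Lemma integral_periodization (h : R) (g : R -> \bar R) : 0 < h ->
  measurable_fun setT g -> (forall x, (0 <= g x)%E) ->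
  (\int[mu]_x g x =
   \int[mu]_(t in `[0%R, h[) \esum_(n in [set: int]) g (t - n%:~R * h)%R)%E.
Proof.
move=> h0 mg g0.
pose F k : set R := [set x | 0 <= x + (nat_int k)%:~R * h < h].
have FE k : F k = (fun x => x + (nat_int k)%:~R * h) @^-1` `[0, h[%classic.
  by apply/seteqP; split => x /=; rewrite in_itv.
have mF k : measurable (F k).
  rewrite FE -[X in measurable X]setTI.
  exact: (measurable_shift _ measurableT).
have FP k x : F k x -> nat_int k = - Num.floor (x / h).
  move=> /andP[x0 xh]; rewrite (@floor_def _ _ (- nat_int k)) ?opprK//.
  rewrite intrD intrN ler_pdivlMr// ltr_pdivrMr//; apply/andP; split; lra.
have tF : trivIset setT F.
  apply/trivIsetP => i j _ _ ij; apply/seteqP; split => // x [/FP iE /FP jE].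
  have [_ inj _] := nat_int_bij.
  by move/eqP: ij; apply; apply: inj; rewrite ?iE ?jE ?inE.
have UF : \bigcup_k F k = setT.
  apply/seteqP; split => // x _.
  have [_ _ /(_ (- Num.floor (x / h)) I)[k _ kE]] := nat_int_bij.
  exists k => //=; rewrite /F/= kE intrN.
  have := floor_itv (x / h); rewrite intrD ler_pdivlMr// ltr_pdivrMr//.
  by move=> /andP[? ?]; apply/andP; split; lra.
rewrite -{1}UF ge0_integral_bigcup//; last first.
  by rewrite UF.
transitivity (\int[mu]_(t in `[0%R, h[) \sum_(k <oo) g (t - (nat_int k)%:~R * h)%R)%E; last first.
  apply: eq_integral => t _.
  rewrite nneseries_esumT//.
  by rewrite -(reindex_esum _ _ _ (fun n : int => g (t - n%:~R * h)%R) nat_int_bij).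
have mgs k : measurable_fun setT (fun t : R => g (t - (nat_int k)%:~R * h)%R).
  exact: measurableT_comp mg (measurable_shift (- _)).
rewrite integral_nneseries//; last by move=> n; apply: measurable_funTS; exact: mgs.
apply: eq_eseriesr => k _.
rewrite integral_mkcond [RHS]integral_mkcond.
rewrite -(@ge0_integral_shift R (- ((nat_int k)%:~R * h)))//.
- apply: eq_integral => t _; rewrite !patchE.
  congr (if _ then _ else _).
  by apply/idP/idP => /set_mem H; apply/mem_set; move: H; rewrite /F/= in_itv/= subrK.
- apply: (measurable_restrictT g (mF k)).1; exact: (measurable_funS measurableT _ mg).
- by move=> x; rewrite patchE; case: ifP.
Qed.

(* Parseval for Fourier series on [c, c + T[, applied to expi (- x t) f (x) and
   integrated over t in [0, 1/T[. *)
Theorem plancherel_itv (f : R -> R[i]) (c d : R) : L2 f ->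
  (forall x, ~ `[c, d]%classic x -> f x = 0) ->
  sqnorm2 (fourier_on setT f) = sqnorm2 f.
Proof.
move=> Lf f0.
(* The maximum keeps T positive when d < c; the added 1 fits the closed [c, d] into the half-open
   [c, c + T[. *)
pose T := Num.max (d - c) 0 + 1.
have T0 : 0 < T by rewrite ltr_wpDl// le_max lexx orbT.
have dT : d < c + T.
  rewrite -ltrBlDl /T (le_lt_trans (_ : _ <= Num.max (d - c) 0))// ?ltrDl//.
  by rewrite le_max lexx.
have h0 : 0 < T^-1 by rewrite invr_gt0.
have mf := L2_cmeasurable Lf.
rewrite {1}/sqnorm2 (integral_periodization h0); last 2 first.
  by apply: measurable_sqr_cabs_EFin; exact: cmeasurable_fourier_on.
  by move=> x; rewrite lee_fin sqr_ge0.
transitivity (\int[mu]_(t in `[0%R, (T^-1)%R[) (T%:E * sqnorm2 f))%E; last first.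
  rewrite [LHS](integral_cst mu (measurable_itv _) (T%:E * sqnorm2 f)%E).
  have muI : lebesgue_measure `[0, T^-1[%classic = (T^-1)%:E.
    by rewrite lebesgue_measure_itv/= lte_fin h0 sube0.
  rewrite [LHS](_ : _ = T%:E * sqnorm2 f * (T^-1)%:E)%E; last by rewrite -muI.
  rewrite sqnorm2E// -!EFinM.
  by rewrite mulrAC divff ?mul1r// gt_eqF.
apply: eq_integral => t _.
pose F x := expi (- (x * t)) * f x.
have LF : L2 F by apply: L2_expi => //; apply: measurable_funN; exact: measurable_funM.
rewrite (_ : sqnorm2 f = sqnorm2 F); last first.
  by apply: eq_sqnorm2 => x; rewrite cabsM cabs_expi mul1r.
rewrite -(fourier_series_parseval (a := c) T0 LF).
- apply: eq_esum => n _; congr (cabs _ ^+ 2)%:E; apply: eq_cintegral => x.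
  rewrite /F mulrA -expiD mulrC; congr (expi _ * _); ring.
- move=> x xD; rewrite /F f0 ?mulr0//; apply: contra_not xD => /=.
  by rewrite !in_itv/= => /andP[-> /le_lt_trans ->].
Qed.

End fourier_compact_support.

(** * Convergence in L^2 and truncation *)

Section L2_convergence.
Context {R : realType}.
Notation mu := (@lebesgue_measure R).
Implicit Types (f g h : R -> R[i]) (F G : nat -> R -> R[i]).

Definition cvgL2 F f := nrm2 (fun x => F n x - f x) @[n --> \oo] --> 0.

Lemma cvg_eq0 (u v : nat -> R) : (forall n, 0 <= u n <= v n) ->
  v n @[n --> \oo] --> 0 -> u n @[n --> \oo] --> 0.
Proof. by move=> uv v0; apply: (squeeze_cvgr _ (cvg_cst 0) v0); exact: nearW. Qed.

Lemma cvg0_cst (a : R) (v : nat -> R) : 0 <= a -> (forall n, a <= v n) ->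
  v n @[n --> \oo] --> 0 -> a = 0.
Proof.
move=> a0 av v0; have /(cvg_unique (@Rhausdorff R)) : (fun=> a) n @[n --> \oo] --> (0 : R).
  by apply: cvg_eq0 v0 => n; rewrite a0 av.
by move=> /(_ _ (cvg_cst a)).
Qed.

Lemma cvg0D (u v : nat -> R) : u n @[n --> \oo] --> 0 -> v n @[n --> \oo] --> 0 ->
  2 * (u n + v n) @[n --> \oo] --> 0.
Proof.
move=> u0 v0; rewrite -[X in _ --> X](mulr0 2); apply: cvgM; first exact: cvg_cst.
by rewrite -[X in _ --> X](addr0 0); apply: cvgD.
Qed.

Lemma cvgL2_near F G f : (forall n, L2 (F n)) -> (forall n, L2 (G n)) -> L2 f ->
  cvgL2 F f -> nrm2 (fun x => G n x - F n x) @[n --> \oo] --> 0 -> cvgL2 G f.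
Proof.
move=> LF LG Lf Ff GF; apply: cvg_eq0 (cvg0D GF Ff) => n.
by rewrite nrm2_ge0 nrm2B_le.
Qed.

Lemma cvgL2_dist F G f : (forall n, L2 (F n)) -> (forall n, L2 (G n)) -> L2 f ->
  cvgL2 F f -> cvgL2 G f -> nrm2 (fun x => F n x - G n x) @[n --> \oo] --> 0.
Proof.
move=> LF LG Lf Ff Gf; apply: cvg_eq0 (cvg0D Ff Gf) => n.
by rewrite nrm2_ge0/= (nrm2BC (G n)) nrm2B_le.
Qed.

Lemma cvgL2_unique F f g : (forall n, L2 (F n)) -> L2 f -> L2 g ->
  cvgL2 F f -> cvgL2 F g -> {ae mu, forall x, f x = g x}.
Proof.
move=> LF Lf Lg Ff Fg; apply: nrm2_ae_eq => //.
apply: (cvg0_cst (nrm2_ge0 _) _ (cvg0D Ff Fg)) => n.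
by rewrite (nrm2BC (F n) f) nrm2B_le.
Qed.

Lemma inner2_cvg F G f g : (forall n, L2 (F n)) -> (forall n, L2 (G n)) ->
  L2 f -> L2 g -> cvgL2 F f -> cvgL2 G g ->
  cabs (inner2 (F n) (G n) - inner2 f g) ^+ 2 @[n --> \oo] --> 0.
Proof.
move=> LF LG Lf Lg Ff Gg.
pose u n := nrm2 (fun x => F n x - f x); pose v n := nrm2 (fun x => G n x - g x).
have uv0 : u n * (2 * (v n + nrm2 g)) @[n --> \oo] --> 0.
  rewrite -[X in _ --> X](mul0r (2 * (0 + nrm2 g))).
  apply: cvgM => //; apply: cvgM; first exact: cvg_cst.
  by apply: cvgD => //; exact: cvg_cst.
have v0 : nrm2 f * v n @[n --> \oo] --> 0.
  by rewrite -[X in _ --> X](mulr0 (nrm2 f)); apply: cvgM => //; exact: cvg_cst.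
apply: cvg_eq0 (cvg0D uv0 v0) => n; rewrite sqr_ge0 andTb.
have LFf := L2B (LF n) Lf; have LGg := L2B (LG n) Lg.
rewrite [X in cabs X](_ : _ =
    inner2 (fun x => F n x - f x) (G n) + inner2 f (fun x => G n x - g x)); last first.
  by rewrite inner2B// inner2Br// addrA subrK.
apply: le_trans (sqr_cabsD_le _ _) _; rewrite ler_pM2l// lerD//.
  apply: le_trans (cauchy_schwarz LFf (LG n)) _; rewrite ler_wpM2l ?nrm2_ge0//.
  by have := nrm2D_le LGg Lg; under [X in nrm2 X]eq_fun do rewrite subrK.
exact: cauchy_schwarz.
Qed.

(** The passage from truncations to all of L^2: both Plancherel and the adjoint formula are obtained
    through it. *)
Lemma inner2_cvg_eq F G f g F' G' f' g' :
  (forall n, L2 (F n)) -> (forall n, L2 (G n)) -> L2 f -> L2 g ->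
  (forall n, L2 (F' n)) -> (forall n, L2 (G' n)) -> L2 f' -> L2 g' ->
  cvgL2 F f -> cvgL2 G g -> cvgL2 F' f' -> cvgL2 G' g' ->
  (forall n, inner2 (F n) (G n) = inner2 (F' n) (G' n)) ->
  inner2 f g = inner2 f' g'.
Proof.
move=> LF LG Lf Lg LF' LG' Lf' Lg' Ff Gg Ff' Gg' FG.
have c1 := inner2_cvg LF LG Lf Lg Ff Gg.
have c2 := inner2_cvg LF' LG' Lf' Lg' Ff' Gg'.
apply/eqP; rewrite -subr_eq0; apply/eqP/cabs_eq0/eqP; rewrite -sqrf_eq0; apply/eqP.
apply: (cvg0_cst (sqr_ge0 _) _ (cvg0D c2 c1)) => n.
rewrite -(cabsN (inner2 (F n) (G n) - _)); apply: le_trans (sqr_cabsD_le _ _).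
rewrite [X in _ <= cabs X ^+ 2](_ : _ = inner2 f g - inner2 f' g')//.
by rewrite -FG; ring.
Qed.

Lemma cvgL2_J F f : cvgL2 F f -> cvgL2 (fun n x => conjc (F n x)) (fun x => conjc (f x)).
Proof.
rewrite /cvgL2; under eq_fun do rewrite /nrm2.
move=> H; under eq_fun do rewrite /nrm2.
rewrite (_ : (fun n => _) = (fun n => fine (sqnorm2 (fun x => F n x - f x))))//.
apply/funext => n; congr fine; apply: eq_sqnorm2 => x.
by rewrite -rmorphB/= cabs_conj.
Qed.

Definition truncate (n : nat) f : R -> R[i] :=
  fun x => (\1_`[- n%:R, n%:R]%classic x)%:C * f x.

Lemma L2_truncate n f : L2 f -> L2 (truncate n f).
Proof. by apply: L2_indic; exact: measurable_itv. Qed.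

Lemma truncate_out n f x : ~ `[- n%:R, n%:R]%classic x -> truncate n f x = 0.
Proof. by move=> xn; rewrite /truncate indicE memNset// mul0r. Qed.

Lemma cvgL2_truncate f : L2 f -> cvgL2 (truncate^~ f) f.
Proof.
move=> Lf.
have [|||||_ _] := @dominated_convergence _ _ R mu setT measurableT
    (fun n x => (cabs (truncate n f x - f x) ^+ 2)%:E) (fun=> 0%E)
    (fun x => (cabs (f x) ^+ 2)%:E).
- move=> n; apply: measurable_sqr_cabs_EFin; apply: L2_cmeasurable.
  by apply: L2B => //; exact: L2_truncate.
- exact: measurable_cst.
- apply: ae_true => x _; apply: cvg_EFin; first exact: nearW.
  apply: cvg_near_cst; near=> n; rewrite /= /truncate indicE mem_set ?mul1r ?subrr ?cabs0 ?expr0n//.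
  have : `|x| <= n%:R by near: n; exact: nbhs_infty_ger.
  by rewrite ler_norml /= in_itv.
- exact: L2_integrable.
- apply: ae_true => x n _; rewrite lee_fin ger0_norm ?sqr_ge0//.
  rewrite /truncate indicE; case: (_ \in _); first by rewrite mul1r subrr cabs0 expr0n sqr_ge0.
  by rewrite mul0r sub0r cabsN.
rewrite integral0 => /fine_cvgP[_]; rewrite /cvgL2 /nrm2 /=.
by rewrite (_ : (fun n => _) = (fine \o (fun n => sqnorm2 (fun x => truncate n f x - f x)))).
Unshelve. all: end_near. Qed.

End L2_convergence.

(** * Plancherel's theorem on L^2 *)

Section fourier_L2.
Context {R : realType}.
Notation mu := (@lebesgue_measure R).
Notation ft := (@fourier_on R setT).
Implicit Types (f g h : R -> R[i]) (F G : nat -> R -> R[i]).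

(** For these functions the Fourier integral converges absolutely and [plancherel_itv] applies. *)
Definition L2_compact f := L2 f /\
  exists c d : R, forall x, ~ `[c, d]%classic x -> f x = 0.

Lemma L2_compact_cintegrable f : L2_compact f -> cintegrable f.
Proof. by move=> [Lf [c [d f0]]]; exact: L2_itv_cintegrable f0. Qed.

Lemma L2_compactD f g : L2_compact f -> L2_compact g ->
  L2_compact (fun x => f x + g x).
Proof.
move=> [Lf [c [d f0]]] [Lg [c' [d' g0]]]; split; first exact: L2D.
exists (Num.min c c'), (Num.max d d') => x /= xn.
rewrite f0 ?g0 ?addr0//; apply: contra_not xn => /=; rewrite !in_itv/= => /andP[cx xd].
- by rewrite ge_min cx orbT le_max xd orbT.
- by rewrite ge_min cx le_max xd.
Qed.

Lemma L2_compactM f h (M : R) : cmeasurable h -> (forall x, cabs (h x) <= M) ->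
  L2_compact f -> L2_compact (fun x => h x * f x).
Proof.
move=> mh hM [Lf [c [d f0]]]; split; first exact: L2Mbdd hM Lf.
by exists c, d => x /f0 ->; rewrite mulr0.
Qed.

Lemma L2_compactZ f z : L2_compact f -> L2_compact (fun x => z * f x).
Proof. exact: L2_compactM (cmeasurable_cst z) (fun=> lexx _). Qed.

Lemma L2_compactB f g : L2_compact f -> L2_compact g ->
  L2_compact (fun x => f x - g x).
Proof.
move=> cf cg; under eq_fun do rewrite -mulN1r.
by apply: L2_compactD => //; exact: L2_compactZ.
Qed.

Lemma L2_compact_truncate n f : L2 f -> L2_compact (truncate n f).
Proof.
move=> Lf; split; first exact: L2_truncate.
by exists (- n%:R), n%:R => x; exact: truncate_out.
Qed.

Lemma cintegrable_expi (k : R -> R) f : measurable_fun setT k -> cintegrable f ->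
  cintegrable (fun x => f x * expi (k x)).
Proof.
move=> mk fi; under eq_fun do rewrite mulrC.
apply: (cintegrableMbdd (M := 1)) => //; first exact: cmeasurable_expi.
by move=> x; rewrite cabs_expi.
Qed.

Lemma measurable_ft_phase (y : R) : measurable_fun setT (fun x : R => - (x * y)).
Proof. by apply: measurable_funN; exact: measurable_funM. Qed.

Lemma ft_linear f g z y : cintegrable f -> cintegrable g ->
  ft (fun x => f x + z * g x) y = ft f y + z * ft g y.
Proof.
move=> fi gi; rewrite /fourier_on -cintegralZ; last first.
  by apply: cintegrable_expi => //; exact: measurable_ft_phase.
rewrite -cintegralD.
- by apply: eq_cintegral => x; rewrite mulrDl mulrA.
- by apply: cintegrable_expi => //; exact: measurable_ft_phase.
- by apply: cintegrableZ; apply: cintegrable_expi => //; exact: measurable_ft_phase.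
Qed.

Lemma ftB f g y : cintegrable f -> cintegrable g ->
  ft (fun x => f x - g x) y = ft f y - ft g y.
Proof.
move=> fi gi; rewrite -mulN1r -ft_linear//.
by congr (ft _ y); apply/funext => x; rewrite mulN1r.
Qed.

Lemma ft_isometry f : L2_compact f -> sqnorm2 (ft f) = sqnorm2 f.
Proof. by move=> [Lf [c [d f0]]]; exact: plancherel_itv f0. Qed.

Lemma L2_ft f : L2_compact f -> L2 (ft f).
Proof.
move=> cf; have [Lf _] := cf; split.
- exact/cmeasurable_fourier_on/L2_cmeasurable.
- by rewrite ft_isometry//; case: Lf.
Qed.

Lemma nrm2_ft f : L2_compact f -> nrm2 (ft f) = nrm2 f.
Proof. by move=> cf; rewrite /nrm2 ft_isometry. Qed.

Lemma nrm2_ftB f g : L2_compact f -> L2_compact g ->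
  nrm2 (fun y => ft f y - ft g y) = nrm2 (fun x => f x - g x).
Proof.
move=> cf cg; rewrite -(nrm2_ft (L2_compactB cf cg)); congr nrm2.
by apply/funext => y; rewrite ftB//; exact: L2_compact_cintegrable.
Qed.

(* polarization: Re <f, z g> for z = 1 and z = i determines <f, g> *)
Lemma inner2_ft f g : L2_compact f -> L2_compact g ->
  inner2 (ft f) (ft g) = inner2 f g.
Proof.
move=> cf cg; have [Lf _] := cf; have [Lg _] := cg.
have Lff := L2_ft cf; have Lfg := L2_ft cg.
have H z : complex.Re (conjc z * inner2 (ft f) (ft g)) = complex.Re (conjc z * inner2 f g).
  have cz := L2_compactZ z cg.
  have := nrm2_ft (L2_compactD cf cz).
  rewrite (_ : ft _ = (fun y => ft f y + z * ft g y)); last first.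
    by apply/funext => y; rewrite ft_linear//; exact: L2_compact_cintegrable.
  rewrite !nrm2D//; [|exact: L2Z..].
  rewrite !inner2Zr// !nrm2Z// !nrm2_ft//; lra.
have := H 1; have := H 'i; rewrite conjc1 !mul1r.
move: (inner2 (ft f) (ft g)) (inner2 f g) => [a b] [u v] /=.
by rewrite !mulN1r !mul0r !opprK !add0r => -> ->.
Qed.

Lemma fourier_on_truncate n f : fourier_on `[- n%:R, n%:R] f = ft (truncate n f).
Proof.
apply/funext => y; rewrite /fourier_on cintegral_mkcond.
by apply: eq_cintegral => x; rewrite mulrA.
Qed.

Lemma is_fourierP f g : L2 f -> is_fourier f g <->
  L2 g /\ cvgL2 (fun n => ft (truncate n f)) g.
Proof.
move=> Lf.
have E n : L2 g -> sqnorm2 (fun y => g y - fourier_on `[- n%:R, n%:R] f y) =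
    (nrm2 (fun y => ft (truncate n f) y - g y))%:E.
  move=> Lg; rewrite nrm2BC fourier_on_truncate sqnorm2E//.
  by apply: L2B => //; apply: L2_ft; exact: L2_compact_truncate.
split=> -[Lg H]; split => //.
- move: H; under eq_fun do rewrite E//.
  by move=> /fine_cvgP[_]; exact.
- by under eq_fun do rewrite E//; apply: cvg_EFin; [exact: nearW|exact: H].
Qed.

(** The transforms of the truncations are as close to each other as the truncations themselves,
    hence Cauchy. This ensures that [fourier] does not fall back on its default value 0. *)
Lemma fourier_exists f : L2 f -> exists g, is_fourier f g.
Proof.
move=> Lf; have ct n := L2_compact_truncate n Lf.
have [||g Lg gP] := @riesz_fischer R (fun n => ft (truncate n f)).
- by move=> n; exact: L2_ft.
- move=> e e0; have e4 : 0 < e / 4 by rewrite divr_gt0.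
  have /cvgrPdist_le/(_ _ e4)[N _ HN] := cvgL2_truncate Lf.
  have HN' m : (N <= m)%N -> nrm2 (fun x => truncate m f x - f x) <= e / 4.
    by move=> /HN /=; rewrite sub0r normrN ger0_norm ?nrm2_ge0.
  exists N => m n Nm Nn; rewrite nrm2_ftB//.
  apply: le_trans (nrm2B_le (L2_truncate m Lf) Lf (L2_truncate n Lf)) _.
  by rewrite [X in _ + X]nrm2BC; have := HN' m Nm; have := HN' n Nn; lra.
by exists g; apply/is_fourierP.
Qed.

Lemma fourierP f : L2 f ->
  L2 (fourier f) /\ cvgL2 (fun n => ft (truncate n f)) (fourier f).
Proof.
move=> Lf; apply/is_fourierP => //; rewrite /fourier.
by have := xgetPex (fun=> 0) (fourier_exists Lf).
Qed.

Lemma L2_fourier f : L2 f -> L2 (fourier f).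
Proof. by move=> /fourierP[]. Qed.

(** Any compactly supported approximation computes the transform, because [ft] is isometric.
    Truncations alone would not do: a translated truncation is not the truncation of the
    translate. *)
Lemma fourier_unique F f g : (forall n, L2_compact (F n)) -> L2 f -> L2 g ->
  cvgL2 F f -> cvgL2 (fun n => ft (F n)) g -> {ae mu, forall y, fourier f y = g y}.
Proof.
move=> cF Lf Lg Ff Fg; have [Lff ff] := fourierP Lf.
have ct n := L2_compact_truncate n Lf.
have LF n : L2 (F n) by case: (cF n).
have LftF n : L2 (ft (F n)) by exact: L2_ft.
have Lftt n : L2 (ft (truncate n f)) by exact: L2_ft.
suff H : cvgL2 (fun n => ft (F n)) (fourier f).
  exact: (cvgL2_unique LftF Lff Lg H Fg).
apply: (cvgL2_near Lftt LftF Lff ff).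
under eq_fun do rewrite nrm2_ftB//.
exact: (cvgL2_dist LF (fun n => L2_truncate n Lf) Lf Ff (cvgL2_truncate Lf)).
Qed.

Theorem inner2_fourier f g : L2 f -> L2 g ->
  inner2 (fourier f) (fourier g) = inner2 f g.
Proof.
move=> Lf Lg; have [Lff ff] := fourierP Lf; have [Lfg fg] := fourierP Lg.
have Lftt h : L2 h -> forall n, L2 (ft (truncate n h)).
  by move=> Lh n; apply: L2_ft; exact: L2_compact_truncate.
have Lt h : L2 h -> forall n, L2 (truncate n h) by move=> Lh n; exact: L2_truncate.
apply: (inner2_cvg_eq (Lftt _ Lf) (Lftt _ Lg) Lff Lfg (Lt _ Lf) (Lt _ Lg) Lf Lg
  ff fg (cvgL2_truncate Lf) (cvgL2_truncate Lg)) => n.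
by apply: inner2_ft; exact: L2_compact_truncate.
Qed.

Theorem plancherel f : L2 f -> sqnorm2 (fourier f) = sqnorm2 f.
Proof.
move=> Lf; have Lff := L2_fourier Lf.
by rewrite !sqnorm2E// !nrm2E inner2_fourier.
Qed.

End fourier_L2.

(** * Fubini and surjectivity of the Fourier transform *)

Section fourier_inversion.
Context {R : realType}.
Notation mu := (@lebesgue_measure R).
Notation ft := (@fourier_on R setT).
Implicit Types (f g h : R -> R[i]).

(** The product bound makes h integrable over the plane, by Tonelli, and over every horizontal and
    vertical line, so that the inner [fine] loses nothing. *)
Lemma Rintegral_fubini (h : R * R -> R) (a b : R -> R) :
  measurable_fun setT h ->
  mu.-integrable setT (EFin \o a) -> mu.-integrable setT (EFin \o b) ->
  (forall x, 0 <= a x) -> (forall y, 0 <= b y) ->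
  (forall x y, `|h (x, y)| <= a x * b y) ->
  \int[mu]_x \int[mu]_y h (x, y) = \int[mu]_y \int[mu]_x h (x, y).
Proof.
move=> mh ia ib a0 b0 hab.
have mE : measurable_fun setT (EFin \o h) by exact/measurable_EFinP.
have i1 x : mu.-integrable setT (fun y => (h (x, y))%:E).
  apply: (@le_integrable _ _ _ mu setT measurableT _ (fun y => (a x)%:E * (b y)%:E)%E).
  - apply/measurable_EFinP.
    exact: measurableT_comp mh (@measurable_pair1 _ _ R R x).
  - by move=> y _; rewrite -EFinM lee_fin (le_trans (hab x y))// ler_norm.
  - exact: (integrableZl measurableT (a x) ib).
have i2 y : mu.-integrable setT (fun x => (h (x, y))%:E).
  apply: (@le_integrable _ _ _ mu setT measurableT _ (fun x => (b y)%:E * (a x)%:E)%E).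
  - apply/measurable_EFinP.
    exact: measurableT_comp mh (@measurable_pair2 _ _ R R y).
  - by move=> x _; rewrite -EFinM lee_fin mulrC (le_trans (hab x y))// ler_norm.
  - exact: (integrableZl measurableT (b y) ia).
have ih := @integrable12ltyP _ _ (measurableTypeR R) (measurableTypeR R) R mu mu (EFin \o h) mE.
have /ih fub : (\int[mu]_x \int[mu]_y `|(h (x, y))%:E| < +oo)%E.
  have := integrable_lty measurableT ia.
  move: (integrable_lty measurableT ib) => boo aoo.
  pose B := fine (\int[mu]_y (b y)%:E)%E.
  apply: (@le_lt_trans _ _ (\int[mu]_x ((a x)%:E * B%:E))%E).
    apply: ge0_le_integral => //.
    - by move=> x _; exact: integral_ge0.
    - apply: (@measurable_integral_param R (fun z => `|(h z)%:E|%E)) => //.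
      exact: measurableT_comp.
    - apply/measurable_EFinP; apply: measurable_funM => //.
      by apply/measurable_EFinP; exact: measurable_int ia.
    - move=> x _; rewrite /B fineK; last exact: integrable_fin_num.
      rewrite -integralZl//; apply: ge0_le_integral => //.
      + by move/measurable_int: (i1 x) => mi; exact: measurableT_comp.
      + apply/measurable_EFinP; apply: measurable_funM => //.
        by apply/measurable_EFinP; exact: measurable_int ib.
      + by move=> y _; rewrite -EFinM lee_fin.
  by apply: integrable_lty => //; exact: (integrableZr measurableT B ia).
rewrite /Rintegral; congr fine.
have Fub := @Fubini _ _ (measurableTypeR R) (measurableTypeR R) R mu mu (EFin \o h) fub.
rewrite (_ : (\int[mu]_x _)%E = (\int[mu]_x \int[mu]_y (EFin \o h) (x, y))%E); last first.
  by apply: eq_integral => x _; rewrite fineK//; exact: integrable_fin_num.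
rewrite [RHS](_ : _ = (\int[mu]_y \int[mu]_x (EFin \o h) (x, y))%E)//.
by apply: eq_integral => y _; rewrite fineK//; exact: integrable_fin_num.
Qed.

Lemma cintegral_fubini (H : R * R -> R[i]) (a b : R -> R) :
  measurable_fun setT (fun z => complex.Re (H z)) ->
  measurable_fun setT (fun z => complex.Im (H z)) ->
  mu.-integrable setT (EFin \o a) -> mu.-integrable setT (EFin \o b) ->
  (forall x, 0 <= a x) -> (forall y, 0 <= b y) ->
  (forall x y, cabs (H (x, y)) <= a x * b y) ->
  cintegral setT (fun x => cintegral setT (fun y => H (x, y))) =
  cintegral setT (fun y => cintegral setT (fun x => H (x, y))).
Proof.
move=> mr mi ia ib a0 b0 Hab; apply: eq_ReIm => /=.
- apply: (Rintegral_fubini mr ia ib) => // x y.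
  exact: le_trans (normr_Re_le _) (Hab x y).
- apply: (Rintegral_fubini mi ia ib) => // x y.
  exact: le_trans (normr_Im_le _) (Hab x y).
Qed.

(** Both sides are the double integral of f(x) g(y) exp(-2 pi i x y), whose kernel is symmetric in x
    and y. *)
Lemma ft_adjoint f g : cintegrable f -> cintegrable g ->
  cintegral setT (fun x => f x * ft g x) = cintegral setT (fun y => g y * ft f y).
Proof.
move=> fi gi; have mf := cintegrable_cmeasurable fi; have mg := cintegrable_cmeasurable gi.
pose H (z : R * R) := (f z.1 * g z.2) * expi (- (z.1 * z.2)).
transitivity (cintegral setT (fun x => cintegral setT (fun y => H (x, y)))).
  apply: eq_cintegral => x; rewrite /fourier_on -cintegralZ.
    by apply: eq_cintegral => y; rewrite /H/= mulrA (mulrC y).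
  by apply: cintegrable_expi => //; exact: measurable_ft_phase.
transitivity (cintegral setT (fun y => cintegral setT (fun x => H (x, y)))); last first.
  apply: eq_cintegral => y; rewrite /fourier_on -cintegralZ.
    by apply: eq_cintegral => x; rewrite /H/= mulrA (mulrC (f x)).
  by apply: cintegrable_expi => //; exact: measurable_ft_phase.
have m1 (u : R -> R) : measurable_fun setT u -> measurable_fun setT (fun z : R * R => u z.1).
  by move=> mu'; exact: measurableT_comp mu' (@measurable_fst _ _ R R).
have m2 (u : R -> R) : measurable_fun setT u -> measurable_fun setT (fun z : R * R => u z.2).
  by move=> mu'; exact: measurableT_comp mu' (@measurable_snd _ _ R R).
have mp : measurable_fun [set: R * R] (fun z : R * R => 2 * pi * - (z.1 * z.2)).
  apply: measurable_funM => //; apply: measurable_funN.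
  exact: measurable_funM (@measurable_fst _ _ R R) (@measurable_snd _ _ R R).
have mc := measurableT_comp (continuous_measurable_fun (@continuous_cos R)) mp.
have ms := measurableT_comp (continuous_measurable_fun (@continuous_sin R)) mp.
have [fr fim] := mf; have [gr gim] := mg.
have mre : measurable_fun setT (fun z : R * R => complex.Re (f z.1 * g z.2)).
  under eq_fun do rewrite cReM.
  by apply: measurable_funB; apply: measurable_funM;
    [exact: m1 fr|exact: m2 gr|exact: m1 fim|exact: m2 gim].
have mim : measurable_fun setT (fun z : R * R => complex.Im (f z.1 * g z.2)).
  under eq_fun do rewrite cImM.
  by apply: measurable_funD; apply: measurable_funM;
    [exact: m1 fr|exact: m2 gim|exact: m1 fim|exact: m2 gr].
apply: (cintegral_fubini _ _ (cintegrable_cabs fi) (cintegrable_cabs gi)).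
- under eq_fun do rewrite /H cReM.
  by apply: measurable_funB; apply: measurable_funM.
- under eq_fun do rewrite /H cImM.
  by apply: measurable_funD; apply: measurable_funM.
- by move=> x; exact: cabs_ge0.
- by move=> x; exact: cabs_ge0.
- by move=> x y; rewrite /H cabsM cabs_expi mulr1 cabsM.
Qed.

(** The conjugations write the bilinear identity [ft_adjoint] with inner products, the form in which
    it passes to L^2 limits. *)
Lemma fourier_adjoint f g : L2 f -> L2 g ->
  inner2 (fourier f) (fun y => conjc (g y)) = inner2 f (fun x => conjc (fourier g x)).
Proof.
move=> Lf Lg; have [Lff ff] := fourierP Lf; have [Lfg fg] := fourierP Lg.
have Lt h : L2 h -> forall n, L2 (truncate n h) by move=> Lh n; exact: L2_truncate.
have Lftt h : L2 h -> forall n, L2 (ft (truncate n h)).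
  by move=> Lh n; apply: L2_ft; exact: L2_compact_truncate.
apply: (inner2_cvg_eq (Lftt _ Lf) (fun n => L2J (Lt _ Lg n)) Lff (L2J Lg)
  (Lt _ Lf) (fun n => L2J (Lftt _ Lg n)) Lf (L2J Lfg)
  ff (cvgL2_J (cvgL2_truncate Lg)) (cvgL2_truncate Lf) (cvgL2_J fg)) => n.
have ci h : L2 h -> cintegrable (truncate n h).
  by move=> Lh; apply: L2_compact_cintegrable; exact: L2_compact_truncate.
have := ft_adjoint (ci _ Lf) (ci _ Lg) => H.
rewrite /inner2; under eq_fun do rewrite conjcK mulrC.
by rewrite -H; apply: eq_cintegral => x; rewrite conjcK.
Qed.

(* The inverse is f |-> conj (F (conj f)): it is the adjoint of F, and it is an
   isometry since F is. *)
Theorem fourier_surjective g : L2 g ->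
  exists2 f, L2 f & {ae mu, forall y, fourier f y = g y}.
Proof.
move=> Lg; pose cj (h : R -> R[i]) x := conjc (h x).
pose f := cj (fourier (cj g)).
have Lcg : L2 (cj g) by exact: L2J.
have Lf : L2 f by apply: L2J; exact: L2_fourier.
have Lff := L2_fourier Lf.
exists f => //; apply: nrm2_ae_eq => //.
(* Once fhat and g have the same inner product with every h, their difference is orthogonal to
   itself. *)
have key h : L2 h -> inner2 (fourier f) h = inner2 g h.
  move=> Lh; have Lch : L2 (cj h) by exact: L2J.
  have Lfch := L2_fourier Lch; have Lfcg := L2_fourier Lcg.
  have cJK : (fun y => conjc (cj h y)) = h by apply/funext => y; rewrite conjcK.
  rewrite -{1}cJK fourier_adjoint//.
  transitivity (conjc (inner2 (fourier (cj g)) (fourier (cj h)))).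
    rewrite -cintegralJ; last exact: cintegrable_mulJ.
    by apply: eq_cintegral => x; rewrite cJM.
  rewrite inner2_fourier// -cintegralJ; last exact: cintegrable_mulJ.
  by apply: eq_cintegral => x; rewrite cJM !conjcK.
have Lr := L2B Lff Lg.
by rewrite nrm2E inner2B// key// subrr.
Qed.

End fourier_inversion.

(** * Gabor systems *)

Section modulated_translates.
Context {R : realType}.
Notation mu := (@lebesgue_measure R).
Notation ft := (@fourier_on R setT).
Implicit Types (f g h Phi : R -> R[i]).

(** A form shared by the Gabor elements and their transforms: the Fourier transform sends the
    parameters (b, s) to (s, -b), up to a phase. *)
Definition mod_shift (z : R[i]) (b s : R) h : R -> R[i] :=
  fun x => z * expi (b * x) * h (x + s).

Lemma cmeasurable_mod (z : R[i]) (b : R) : cmeasurable (fun x => z * expi (b * x)).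
Proof.
by apply: cmeasurableM; [exact: cmeasurable_cst|apply: cmeasurable_expi; exact: measurable_funM].
Qed.

Lemma L2_mod_shift z b s h : L2 h -> L2 (mod_shift z b s h).
Proof.
move=> Lh; apply: (L2Mbdd (M := cabs z)); first exact: cmeasurable_mod.
- by move=> x; rewrite cabsM cabs_expi mulr1.
- exact: L2_shift.
Qed.

Lemma nrm2_mod_shift z b s h : L2 h -> nrm2 (mod_shift z b s h) = cabs z ^+ 2 * nrm2 h.
Proof.
move=> Lh; rewrite -nrm2Z// /nrm2; congr fine.
rewrite -(@sqnorm2_shift _ (fun x => z * h x) s); last exact/L2_cmeasurable/L2Z.
by apply: eq_sqnorm2 => x; rewrite !cabsM cabs_expi mulr1.
Qed.

Lemma cvgL2_mod_shift z b s (F : nat -> R -> R[i]) f : (forall n, L2 (F n)) -> L2 f ->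
  cvgL2 F f -> cvgL2 (fun n => mod_shift z b s (F n)) (mod_shift z b s f).
Proof.
move=> LF Lf Ff; rewrite /cvgL2.
have E n : nrm2 (fun x => mod_shift z b s (F n) x - mod_shift z b s f x) =
    cabs z ^+ 2 * nrm2 (fun x => F n x - f x).
  rewrite -(nrm2_mod_shift z b s (L2B (LF n) Lf)).
  by congr nrm2; apply/funext => x; rewrite /mod_shift mulrBr.
have H : cabs z ^+ 2 * nrm2 (fun x => F n x - f x) @[n --> \oo] --> 0.
  by rewrite -[X in _ --> X](mulr0 (cabs z ^+ 2)); apply: cvgM => //; exact: cvg_cst.
by apply: cvg_eq0 H => n; rewrite nrm2_ge0 E lexx.
Qed.

Lemma L2_compact_mod_shift z b s h : L2_compact h -> L2_compact (mod_shift z b s h).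
Proof.
move=> [Lh [c [d h0]]]; split; first exact: L2_mod_shift.
exists (c - s), (d - s) => x xn; rewrite /mod_shift h0 ?mulr0//.
apply: contra_not xn => /=; rewrite !in_itv/= => /andP[? ?].
by apply/andP; split; lra.
Qed.

Lemma ft_mod_shift z b s h : cintegrable h ->
  ft (mod_shift z b s h) = mod_shift (z * expi (- (s * b))) s (- b) (ft h).
Proof.
move=> hi; apply/funext => y; rewrite /fourier_on /mod_shift.
rewrite -cintegralZ; last by apply: cintegrable_expi => //; exact: measurable_ft_phase.
rewrite -[RHS](cintegral_shift s); last first.
  apply: cintegrable_cmeasurable; apply: cintegrableZ.
  by apply: cintegrable_expi => //; exact: measurable_ft_phase.
apply: eq_cintegral => x.
(* The phase is rewritten through x + s and y - b; the remaining factor exp(-2 pi i b x) cancels the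
   modulation. *)
rewrite (_ : expi (- (x * y)) = expi (- (s * b)) * expi (s * y) *
  expi (- ((x + s) * (y - b))) * expi (- (b * x))); last first.
  by rewrite -!expiD; congr expi; ring.
have : expi (b * x) * expi (- (b * x)) = 1 :> R[i] by rewrite -expiD subrr expi0.
move: (expi (b * x)) (expi (- (b * x))) => u v uv.
transitivity (z * expi (- (s * b)) * expi (s * y) * (h (x + s) *
  expi (- ((x + s) * (y - b)))) * (u * v)); first by ring.
by rewrite uv mulr1.
Qed.

Lemma fourier_mod_shift z b s Phi : L2 Phi ->
  {ae mu, forall y, fourier (mod_shift z b s Phi) y =
    mod_shift (z * expi (- (s * b))) s (- b) (fourier Phi) y}.
Proof.
move=> LP; have [LfP fP] := fourierP LP.
have ct n := L2_compact_truncate n LP.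
have LtP n : L2 (truncate n Phi) by exact: L2_truncate.
apply: (fourier_unique (F := fun n => mod_shift z b s (truncate n Phi))).
- by move=> n; exact: L2_compact_mod_shift.
- exact: L2_mod_shift.
- exact: L2_mod_shift.
- exact: cvgL2_mod_shift (cvgL2_truncate LP).
- rewrite (_ : (fun n => ft _) =
      (fun n => mod_shift (z * expi (- (s * b))) s (- b) (ft (truncate n Phi)))).
    by apply: cvgL2_mod_shift => // n; exact: L2_ft.
  apply/funext => n; apply: ft_mod_shift; exact: L2_compact_cintegrable.
Qed.

Lemma inner2_mod_shift f z b s Phi : L2 f -> L2 Phi -> cabs z = 1 ->
  cabs (inner2 f (mod_shift z b s Phi)) = cabs (cintegral setT (fun y =>
    expi (- (s * y)) * (fourier f y * conjc (fourier Phi (y - b))))).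
Proof.
move=> Lf LP z1; have LM := L2_mod_shift z b s LP.
have Lff := L2_fourier Lf; have LfP := L2_fourier LP; have LfM := L2_fourier LM.
rewrite -inner2_fourier//.
have hi : cintegrable (fun y => fourier f y * conjc (fourier Phi (y - b))).
  by apply: cintegrable_mulJ => //; exact: L2_shift.
transitivity (cabs (cintegral setT (fun y => conjc (z * expi (- (s * b))) *
    (expi (- (s * y)) * (fourier f y * conjc (fourier Phi (y - b))))))).
  congr cabs; rewrite /inner2; apply: ae_eq_cintegral.
  - by apply: cintegrable_cmeasurable; exact: cintegrable_mulJ.
  - apply: cmeasurableM; first exact: cmeasurable_cst.
    apply: cmeasurableM; last exact: cintegrable_cmeasurable.
    by apply: cmeasurable_expi; apply: measurable_funN; exact: measurable_funM.
  - apply: aeS (fourier_mod_shift z b s LP) => y ->.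
    by rewrite /mod_shift !cJM !conj_expi opprK; ring.
rewrite cintegralZ; last first.
  apply: (cintegrableMbdd (M := 1)) => //.
  - by apply: cmeasurable_expi; apply: measurable_funN; exact: measurable_funM.
  - by move=> y; rewrite cabs_expi.
by rewrite cabsM cabs_conj cabsM z1 cabs_expi !mul1r.
Qed.

(* For fixed modulation b, the coefficients over all translations by multiples of
   1/lambda are the Fourier coefficients of F (Phihat(. - b))^*, a function
   supported in an interval of length lambda. *)
Lemma esum_translates (lambda a b : R) (zs : int -> R[i]) f Phi : 0 < lambda ->
  L2 f -> L2 Phi -> (forall n, cabs (zs n) = 1) ->
  {ae mu, forall y, ~ `[a, a + lambda[%classic y -> fourier Phi y = 0} ->
  L2 (fun y => fourier f y * fourier Phi (y - b)) ->
  (\esum_(n in [set: int])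
     (cabs (inner2 f (mod_shift (zs n) b (n%:~R / lambda) Phi)) ^+ 2)%:E =
   lambda%:E * sqnorm2 (fun y => fourier f y * fourier Phi (y - b)%R)%R)%E.
Proof.
move=> l0 Lf LP zs1 supp Lprod.
have Lff := L2_fourier Lf; have LfP := L2_fourier LP.
pose I := `[a + b, a + b + lambda[%classic : set R.
have mI : measurable I by exact: measurable_itv.
pose k y := fourier f y * conjc (fourier Phi (y - b)).
have Lk : L2 k.
  apply: (le_L2 (K := 1) _ Lprod).
  - apply: cmeasurableM; first exact: L2_cmeasurable.
    by apply: cmeasurableJ; apply: L2_cmeasurable; exact: L2_shift.
  - by move=> y; rewrite mul1r !cabsM cabs_conj.
(* The support of Phihat is known up to a null set, but [fourier_series_parseval] asks for zeros
   everywhere off the period. *)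
pose h y := (\1_I y)%:C * k y.
have Lh : L2 h by exact: L2_indic.
have hk : {ae mu, forall y, h y = k y}.
  have := ae_shift (- b) supp; apply: aeS => y yb.
  rewrite /h indicE; have [yI|/negP yI] := boolP (y \in I); first by rewrite mul1r.
  rewrite mul0r /k yb ?conjc0 ?mulr0// => H; apply: yI; apply/mem_set.
  by move: H; rewrite /I /= !in_itv/= => /andP[? ?]; apply/andP; split; lra.
have -> : sqnorm2 (fun y => fourier f y * fourier Phi (y - b)) = sqnorm2 h.
  rewrite (@ae_eq_sqnorm2 _ h k); [|exact: L2_cmeasurable..|by apply: aeS hk => y ->].
  by apply: eq_sqnorm2 => y; rewrite !cabsM cabs_conj.
rewrite -(@fourier_series_parseval _ _ (a + b) l0 h)//; last first.
  by move=> y yI; rewrite /h indicE memNset// mul0r.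
(* Translation by n / lambda produces the exponential of frequency - n / lambda, so the sum is
   reindexed by the opposite. *)
have oppbij : set_bij [set: int] [set: int] (fun n : int => - n).
  split => // [m n _ _ /oppr_inj//|n _]; by exists (- n) => //; rewrite opprK.
rewrite (reindex_esum _ _ _ _ oppbij).
apply: eq_esum => n _; congr (_ ^+ 2)%:E; rewrite inner2_mod_shift//.
congr cabs; apply/esym; apply: ae_eq_cintegral.
- apply: cmeasurableM; last exact: L2_cmeasurable.
  by apply: cmeasurable_expi; exact: measurable_lin.
- apply: cmeasurableM; last exact: L2_cmeasurable.
  by apply: cmeasurable_expi; apply: measurable_funN; exact: measurable_funM.
- apply: aeS hk => y ->; congr (expi _ * _).
  by rewrite intrN; ring.
Qed.

End modulated_translates.

(** * Essential supports, bounds almost everywhere, and countable sums *)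

Section essential_support.
Context {R : realType}.
Notation mu := (@lebesgue_measure R).

(** The complement of the support is a union of possibly uncountably many open sets, each with its
    own null set. Intervals with rational endpoints reduce it to countably many. *)
Lemma ess_support_ae (f : R -> R[i]) : {ae mu, forall x, ~ ess_support f x -> f x = 0}.
Proof.
pose V (p : rat * rat) : set R := `]ratr p.1, ratr p.2[%classic.
(* Rational pairs are coded by naturals to fit [ae_forall]; a number that codes no pair imposes no
   condition. *)
pose Q n x := if unpickle n is Some p then
  {ae mu, forall y, V p y -> f y = 0} -> V p x -> f x = 0 else True.
have aeQ n : {ae mu, forall x, Q n x}.
  rewrite /Q; case: unpickle => [p|]; last by exact: ae_true.
  have [aeV|naeV] := pselect {ae mu, forall y, V p y -> f y = 0}.
    by apply: aeS aeV => x.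
  by apply: ae_true => x.
apply: aeS (ae_forall aeQ) => x Qx /contrapT[U [oU aeU] Ux].
have : nbhs x U by exact: open_nbhs_nbhs.
move=> /nbhs_ballP[e /= e0 eU].
have [q1 q1x] : exists q, ratr q \in `]x - e, x[ by apply: rat_in_itvoo; rewrite ltrBlDr ltrDl.
have [q2 q2x] : exists q, ratr q \in `]x, x + e[ by apply: rat_in_itvoo; rewrite ltrDl.
move: q1x q2x; rewrite !in_itv/= => /andP[q1e q1x] /andP[q2x q2e].
have := Qx (pickle (q1, q2)); rewrite /Q pickleK; apply.
- apply: aeS aeU => y Uf; rewrite /V/= in_itv/= => /andP[q1y yq2]; apply: Uf.
  by apply: eU; rewrite /ball/= ltr_norml; apply/andP; split; lra.
- by rewrite /V/= in_itv/= q1x q2x.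
Qed.

(** A positive finite length excludes unbounded and empty intervals. Any other interval is enlarged
    to its closure, and the right endpoint is then given up as a null set. *)
Lemma supported_in_interval_ae (f : R -> R[i]) (len : R) : 0 < len ->
  supported_in_interval_of_length f len ->
  exists a, {ae mu, forall x, ~ `[a, a + len[%classic x -> f x = 0}.
Proof.
move=> len0 [J [muJ fJ]].
have len_neq0 : 0%:E <> len%:E by move=> [] /eqP; rewrite eq_sym gt_eqF.
have [a Ja] : exists a, [set` J] `<=` `[a, a + len].
  move: muJ; rewrite lebesgue_measure_itv; case: J fJ => [[b1 x|[]] [b2 y|[]]] fJ //=;
    do ?[case: ifPn => //= xy]; try by move=> /len_neq0.
  move=> [yx]; exists x => z /=; rewrite !in_itv/=.
  have -> : x + len = y by lra.
  by move=> /andP[/lteifW -> /lteifW ->].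
exists a; have aea : {ae mu, forall x, x != a + len}.
  exists [set a + len]; split => //; first exact: lebesgue_measure_set1.
  by move=> x /= /negP; rewrite negbK => /eqP.
apply: aeS (aeI aea (ess_support_ae f)) => x [xa fx] nx; apply: fx => sx; apply: nx.
have := Ja _ (fJ _ sx); rewrite /= !in_itv/= => /andP[-> xal].
by rewrite lt_neqAle xa.
Qed.

End essential_support.

Section ae_bounds.
Context {R : realType}.
Notation mu := (@lebesgue_measure R).
Local Open Scope ereal_scope.

(** If W >= beta + d on a set E of finite measure, with d > 0, the integral bound gives (beta + d)
    mu E <= beta mu E, so E is null; similarly below alpha. The sets are cut to [-n, n] to have
    finite measure, and d runs through 1 / (k + 1). *)
Lemma ae_bounds_of_integrals (W : R -> \bar R) (alpha beta : R) :
  (0 <= beta)%R -> measurable_fun setT W -> (forall x, 0 <= W x) ->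
  (forall E, measurable E -> mu E < +oo ->
    alpha%:E * mu E <= \int[mu]_(x in E) W x <= beta%:E * mu E) ->
  {ae mu, forall x, alpha%:E <= W x <= beta%:E}.
Proof.
move=> beta0 mW W0 H.
pose B (n : nat) : set R := `[(- n%:R)%R, n%:R]%classic.
have mB n : measurable (B n) by exact: measurable_itv.
have mEB n (E : set R) : measurable E -> measurable (E `&` B n).
  by move=> mE; apply: measurableI => //; exact: mB.
have finB n (E : set R) : measurable E -> mu (E `&` B n) < +oo.
  move=> mE; apply: (@le_lt_trans _ _ (mu (B n))).
    by apply: le_measure; rewrite ?inE//; [exact: mEB|exact: mB].
  rewrite /B lebesgue_measure_itv/=; case: ifPn => _; last by rewrite ltry.
  by rewrite -EFinB ltry.
have mle (c : \bar R) : measurable [set x | W x <= c].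
  by have := emeasurable_fun_infty_c measurableT mW c; rewrite setTI.
have mge (c : \bar R) : measurable [set x | c <= W x].
  by have := emeasurable_fun_c_infty measurableT mW c; rewrite setTI.
have null (E : set R) n : measurable E -> mu (E `&` B n) = 0 ->
    {ae mu, forall x, ~ (E `&` B n) x}.
  move=> mE E0; exists (E `&` B n); split => //; first exact: mEB.
  by move=> x /= /contrapT.
pose d (k : nat) : R := (k.+1%:R^-1)%R.
have d0 k : (0 < d k)%R by rewrite invr_gt0 ltr0n.
pose Eb k := [set x | (beta + d k)%:E <= W x].
pose Ea k := [set x | W x <= (alpha - d k)%:E].
have zero (E : set R) (c e : R) : measurable E -> mu E < +oo -> (0 < e)%R ->
    (c + e)%:E * mu E <= c%:E * mu E -> mu E = 0.
  move=> mE Eoo e0; have : mu E \is a fin_num by rewrite ge0_fin_numE.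
  have : 0 <= mu E by [].
  case: (mu E) => // r; rewrite lee_fin => r0 _; rewrite -!EFinM lee_fin => cer.
  by congr EFin; apply/eqP; rewrite eq_le r0 andbT; nra.
have nb k n : mu (Eb k `&` B n) = 0.
  have mE := mEB n _ (mge (beta + d k)%:E).
  have /andP[_ leb] := H _ mE (finB n _ (mge _)).
  apply: (zero _ beta (d k)) => //; first by apply: finB; exact: mge.
  apply: le_trans leb; rewrite -integral_cst//.
  apply: ge0_le_integral => //.
  - by move=> x _; rewrite lee_fin addr_ge0// ltW.
  - exact: measurable_funTS.
  - by move=> x [].
have na k n : mu (Ea k `&` B n) = 0.
  have mE := mEB n _ (mle (alpha - d k)%:E).
  have /andP[lea _] := H _ mE (finB n _ (mle _)).
  apply: (zero _ (alpha - d k)%R (d k)) => //; first by apply: finB; exact: mle.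
  rewrite subrK; apply: (le_trans lea); rewrite -integral_cst//.
  apply: ge0_le_integral => //.
  - exact: measurable_funTS.
  - by move=> x [].
have aeb := ae_forall (fun k => ae_forall (fun n => null _ n (mge _) (nb k n))).
have aea := ae_forall (fun k => ae_forall (fun n => null _ n (mle _) (na k n))).
apply: aeS (aeI aea aeb) => x [xa xb].
have [n xn] : exists n, B n x.
  have [n xn] : exists n : nat, (`|x| <= n%:R)%R.
    by exists (Num.bound `|x|%R); apply: ltW; exact: archi_boundP.
  by exists n; rewrite /B /= in_itv/= -ler_norml.
have arch (y z : R) : (forall k, y < z + d k)%R -> (y <= z)%R.
  move=> yz; rewrite leNgt; apply/negP => /ltr_add_invr[k].
  by rewrite ltNge (ltW (yz k)).
have {}xa k : ~ (W x <= (alpha - d k)%:E) by move=> Wx; exact: (xa k n).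
have {}xb k : ~ ((beta + d k)%:E <= W x) by move=> Wx; exact: (xb k n).
move: (W0 x) xa xb; case: (W x) => [w| |] // _ xa xb.
- rewrite !lee_fin; apply/andP; split; apply: arch => k.
  + by move/negP: (xa k); rewrite lee_fin -ltNge ltrBlDr.
  + by move/negP: (xb k); rewrite lee_fin -ltNge.
- by exfalso; apply: (xb 0%N); rewrite leey.
Qed.

End ae_bounds.

Section sums_and_integrals.
Context {R : realType}.
Notation mu := (@lebesgue_measure R).
Local Open Scope ereal_scope.

Lemma esum_int (a : int -> \bar R) : (forall l, 0 <= a l) ->
  \esum_(l in [set: int]) a l = \sum_(n <oo) a (nat_int n).
Proof.
by move=> a0; rewrite nneseries_esumT// (reindex_esum _ _ _ _ nat_int_bij).
Qed.

Lemma esum_ord N (a : 'I_N -> \bar R) : (forall j, 0 <= a j) ->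
  \esum_(j in [set: 'I_N]) a j = \sum_(j < N) a j.
Proof.
move=> a0; rewrite esum_fset//.
rewrite (@fsbigE _ _ _ _ _ (index_enum 'I_N)) ?index_enum_uniq//.
- by apply: eq_bigl => j; rewrite in_setT.
- by move=> j _; rewrite mem_index_enum.
- exact: finite_finset.
Qed.

(** The translation index n is placed innermost, because Parseval evaluates that sum for fixed l and
    j. *)
Lemma esum_triple N (a : int * int * 'I_N -> \bar R) : (forall k, 0 <= a k) ->
  \esum_(k in [set: int * int * 'I_N]) a k =
  \sum_(j < N) \esum_(l in [set: int]) \esum_(n in [set: int]) a (n, l, j).
Proof.
move=> a0; rewrite -esum_ord; last first.
  by move=> j; apply: esum_ge0 => l _; apply: esum_ge0.
pose s (m : 'I_N * (int * int)) := (m.2.2, m.2.1, m.1).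
have sbij : set_bij [set: 'I_N * (int * int)] [set: int * int * 'I_N] s.
  split => //; first by move=> [j [l n]] [j' [l' n']] _ _ [-> -> ->].
  by move=> [[n l] j] _; exists (j, (l, n)).
rewrite (reindex_esum _ _ _ _ sbij).
have TX (T1 T2 : choiceType) : [set: T1 * T2] = [set: T1] `*`` (fun=> [set: T2]).
  by apply/seteqP; split.
rewrite TX -(esum_esum (a := fun j p => a (s (j, p))))//.
apply: eq_esum => j _.
by rewrite TX -(esum_esum (a := fun l n => a (s (j, (l, n)))))//.
Qed.

Lemma integral_finsum_series N (g : 'I_N -> nat -> R -> \bar R) :
  (forall j n, measurable_fun setT (g j n)) -> (forall j n x, 0 <= g j n x) ->
  \int[mu]_x (\sum_(j < N) \sum_(n <oo) g j n x) =
  \sum_(j < N) \sum_(n <oo) \int[mu]_x g j n x.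
Proof.
move=> mg g0; rewrite ge0_integral_sum//.
- apply: eq_bigr => j _; apply: integral_nneseries => [|n|n x _].
  + exact: measurableT.
  + exact: mg.
  + exact: g0.
- move=> j; apply: (ge0_emeasurable_sum (P := predT)) => [k x _ _|k _].
  + exact: g0.
  + exact: mg.
- by move=> j x _; exact: nneseries_ge0.
Qed.

End sums_and_integrals.

(** * The frame inequalities as bounds on the Calderón sum *)

Section gabor_frames.
Context {R : realType}.
Notation mu := (@lebesgue_measure R).
Variables (N : nat) (A B lambda : R) (Phi : 'I_N -> R -> R[i]) (p0 q0 : 'I_N -> R).
Hypothesis lambda_gt0 : 0 < lambda.
Hypothesis Phi_L2 : forall j, L2 (Phi j).
Hypothesis Phi_supp : forall j,
  supported_in_interval_of_length (fourier (Phi j)) lambda.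
Hypothesis q0E : forall j, q0 j = 1 / lambda.

Notation freq j l := (A * p0 j * l%:~R).

(** Extended-real valued, since the series over l may diverge as long as no bound is known. *)
Definition calderon_sum (y : R) : \bar R :=
  (lambda%:E * (\sum_(j < N) \esum_(l in [set: int])
     (cabs (fourier (Phi j) (y - freq j l)) ^+ 2)%:E))%E.

Lemma gaborE n l j : gabor A B p0 q0 Phi (n, l, j) =
  mod_shift (expi (2^-1 * A * n%:~R * l%:~R * p0 j * q0 j + B * l%:~R * p0 j))
    (freq j l) (n%:~R / lambda) (Phi j).
Proof.
apply/funext => x; rewrite /gabor /mod_shift q0E mul1r.
by congr (_ * expi _ * _); ring.
Qed.

Lemma L2_gabor k : L2 (gabor A B p0 q0 Phi k).
Proof. by case: k => [[n l] j]; rewrite gaborE; exact: L2_mod_shift. Qed.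

Let w j (n : nat) y := cabs (fourier (Phi j) (y - freq j (nat_int n))) ^+ 2.

Let w_ge0 j n y : (0 <= (w j n y)%:E)%E.
Proof. by rewrite lee_fin sqr_ge0. Qed.

Let L2_w j b : L2 (fun y => fourier (Phi j) (y - b)).
Proof. by apply: L2_shift; exact: L2_fourier. Qed.

Let mw j n : measurable_fun setT (fun y => (w j n y)%:E).
Proof. by apply: measurable_sqr_cabs_EFin; exact: L2_cmeasurable (L2_w j _). Qed.

Lemma calderon_sumE y :
  calderon_sum y = (lambda%:E * \sum_(j < N) \sum_(n <oo) (w j n y)%:E)%E.
Proof.
congr (_ * _)%E; apply: eq_bigr => j _; rewrite esum_int// => l.
by rewrite lee_fin sqr_ge0.
Qed.

Lemma calderon_sum_ge0 y : (0 <= calderon_sum y)%E.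
Proof.
apply: mule_ge0; first by rewrite lee_fin ltW.
apply: sume_ge0 => j _.
by apply: esum_ge0 => l _; rewrite lee_fin sqr_ge0.
Qed.

Lemma measurable_calderon_sum : measurable_fun setT calderon_sum.
Proof.
rewrite (funext calderon_sumE).
apply: emeasurable_funM => //; apply: emeasurable_sum => j.
apply: (ge0_emeasurable_sum (P := predT)) => [k x _ _|k _].
- exact: w_ge0.
- exact: mw.
Qed.

Lemma calderon_term_le j l y :
  ((lambda * cabs (fourier (Phi j) (y - freq j l)) ^+ 2)%:E <= calderon_sum y)%E.
Proof.
rewrite EFinM lee_pmul2l ?lte_fin// (bigD1 j)//=.
have c0 i k : (0 <= (cabs (fourier (Phi i) (y - freq i k)) ^+ 2)%:E)%E.
  by rewrite lee_fin sqr_ge0.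
apply: (@le_trans _ _ (\esum_(k in [set: int])
    (cabs (fourier (Phi j) (y - freq j k)) ^+ 2)%:E)%E).
  apply: esum_ge; exists [set l]; first by split => //; exact: finite_set1.
  by rewrite fsbig_set1.
by rewrite leeDl// sume_ge0// => i _; exact: esum_ge0.
Qed.

(** The second hypothesis is what [esum_translates] asks of each product. All terms are nonnegative,
    so sums and integrals may be exchanged even when infinite. *)
Lemma esum_gabor f : L2 f ->
  (forall j l, L2 (fun y => fourier f y * fourier (Phi j) (y - freq j l))) ->
  (\esum_(k in [set: int * int * 'I_N])
     (cabs (inner2 f (gabor A B p0 q0 Phi k)) ^+ 2)%:E =
   \int[mu]_y ((cabs (fourier f y) ^+ 2)%:E * calderon_sum y))%E.
Proof.
move=> Lf Lprod; have Lff := L2_fourier Lf.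
rewrite esum_triple; last by move=> k; rewrite lee_fin sqr_ge0.
transitivity (\sum_(j < N) \sum_(n <oo) (lambda%:E *
    sqnorm2 (fun y => fourier f y * fourier (Phi j) (y - freq j (nat_int n)))%R))%E.
  apply: eq_bigr => j _; rewrite esum_int; last first.
    by move=> l; apply: esum_ge0 => n _; rewrite lee_fin sqr_ge0.
  have [a supp] := supported_in_interval_ae lambda_gt0 (Phi_supp j).
  apply: eq_eseriesr => m _; set l := nat_int m.
  (* The phase of a Gabor element varies with n, so a whole family of unimodular constants is
     passed. *)
  have tr := esum_translates (zs := fun n : int =>
      expi (2^-1 * A * n%:~R * l%:~R * p0 j * q0 j + B * l%:~R * p0 j))
    lambda_gt0 Lf (Phi_L2 j) (fun n => cabs_expi _) supp (Lprod j l).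
  by apply: etrans tr; apply: eq_esum => n _; rewrite gaborE.
have mF := measurable_sqr_cabs_EFin (L2_cmeasurable Lff).
transitivity (\int[mu]_y \sum_(j < N) \sum_(n <oo)
    (lambda%:E * ((cabs (fourier f y) ^+ 2)%:E * (w j n y)%:E)))%E; last first.
  apply: eq_integral => y _; rewrite calderon_sumE.
  rewrite ge0_sume_distrr; last by move=> j _; exact: nneseries_ge0.
  rewrite ge0_sume_distrr; last first.
    by move=> j _; apply: mule_ge0; [rewrite lee_fin ltW|exact: nneseries_ge0].
  apply: eq_bigr => j _; rewrite -nneseriesZl// -nneseriesZl//; last first.
    by move=> n _; apply: mule_ge0; rewrite ?w_ge0// lee_fin ltW.
  by apply: eq_eseriesr => n _; rewrite muleCA.
rewrite integral_finsum_series.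
- apply: eq_bigr => j _; apply: eq_eseriesr => n _.
  rewrite ge0_integralZl_EFin ?(ltW lambda_gt0)//.
  + by congr (_ * _)%E; apply: eq_integral => y _; rewrite -EFinM cabsM exprMn.
  + by move=> y _; rewrite mule_ge0// lee_fin sqr_ge0.
  + by apply: emeasurable_funM; [exact: mF|exact: mw].
- move=> j n; apply: emeasurable_funM => //.
  by apply: emeasurable_funM; [exact: mF|exact: mw].
- move=> j n y; apply: mule_ge0; first by rewrite lee_fin ltW.
  by rewrite -EFinM lee_fin mulr_ge0 ?sqr_ge0.
Qed.

Lemma frame_of_calderon_bounds alpha beta : 0 < alpha -> 0 < beta ->
  {ae mu, forall y, (alpha%:E <= calderon_sum y <= beta%:E)%E} ->
  is_frame_L2 (gabor A B p0 q0 Phi) alpha beta.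
Proof.
move=> alpha0 beta0 aeW; split => // [k|f Lf]; first exact: L2_gabor.
have Lff := L2_fourier Lf.
have mF := measurable_sqr_cabs_EFin (L2_cmeasurable Lff).
have F0 y : (0 <= (cabs (fourier f y) ^+ 2)%:E)%E by rewrite lee_fin sqr_ge0.
(* A single term of W is already at most beta, so the translate of |Phihat_j|^2 is almost everywhere
   at most beta / lambda, and multiplication by it keeps fhat in L^2. *)
have Lprod j l : L2 (fun y => fourier f y * fourier (Phi j) (y - freq j l)).
  have mprod : cmeasurable (fun y => fourier f y * fourier (Phi j) (y - freq j l)).
    by apply: cmeasurableM; exact: L2_cmeasurable.
  split => //.
  apply: (@le_lt_trans _ _ (\int[mu]_y ((beta / lambda)%:E * (cabs (fourier f y) ^+ 2)%:E))%E).
    apply: ae_ge0_le_integral => //.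
    - by move=> y _; rewrite lee_fin sqr_ge0.
    - exact: measurable_sqr_cabs_EFin.
    - by move=> y _; rewrite mule_ge0// lee_fin divr_ge0 ?(ltW beta0) ?(ltW lambda_gt0).
    - exact: emeasurable_funM.
    - apply: aeS aeW => y /andP[_ Wb] _.
      have := le_trans (calderon_term_le j l y) Wb; rewrite lee_fin => le_b.
      rewrite -EFinM lee_fin cabsM exprMn mulrC ler_wpM2r ?sqr_ge0//.
      by rewrite ler_pdivlMr// mulrC.
  rewrite ge0_integralZl_EFin//; last by rewrite divr_ge0 ?(ltW beta0) ?(ltW lambda_gt0).
  by rewrite -/(sqnorm2 (fourier f)) sqnorm2E// -EFinM ltry.
rewrite esum_gabor// -(plancherel Lf).
have mW := measurable_calderon_sum.
rewrite -(ge0_integralZl_EFin mu measurableT _ mF (ltW alpha0))//.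
rewrite -(ge0_integralZl_EFin mu measurableT _ mF (ltW beta0))//.
apply/andP; split; apply: ae_ge0_le_integral => //.
- by move=> y _; rewrite mule_ge0// lee_fin ltW.
- exact: emeasurable_funM.
- by move=> y _; rewrite mule_ge0// calderon_sum_ge0.
- exact: emeasurable_funM.
- by apply: aeS aeW => y /andP[aW _] _; rewrite muleC lee_wpmul2l.
- by move=> y _; rewrite mule_ge0// calderon_sum_ge0.
- exact: emeasurable_funM.
- by move=> y _; rewrite mule_ge0// lee_fin ltW.
- exact: emeasurable_funM.
- by apply: aeS aeW => y /andP[_ Wb] _; rewrite [leRHS]muleC lee_wpmul2l.
Qed.

(* Tested on the f whose Fourier transform is the indicator of a set E of finite
   measure. Being bounded, it keeps all the products with the Phihat_j in L^2, so
   esum_gabor applies before anything is known about the size of Phihat_j. *)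
Lemma calderon_bounds_of_frame alpha beta :
  is_frame_L2 (gabor A B p0 q0 Phi) alpha beta ->
  {ae mu, forall y, (alpha%:E <= calderon_sum y <= beta%:E)%E}.
Proof.
move=> [alpha0 beta0 _ frame]; apply: ae_bounds_of_integrals.
- exact: ltW.
- exact: measurable_calderon_sum.
- exact: calderon_sum_ge0.
move=> E mE Eoo; pose g y : R[i] := (\1_E y)%:C.
have g2 y : cabs (g y) ^+ 2 = \1_E y.
  by rewrite cabs_real real_normK ?num_real// indicE -natrX; case: (_ \in _).
have mg : cmeasurable g by exact: cmeasurable_indic.
have ng : sqnorm2 g = mu E.
  rewrite /sqnorm2; under eq_integral do rewrite g2.
  by rewrite integral_indic// setIT.
have Lg : L2 g by split => //; rewrite ng.
have [f Lf fg] := fourier_surjective Lg.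
have Lff := L2_fourier Lf.
have nf : sqnorm2 f = mu E.
  rewrite -(plancherel Lf) -ng; apply: ae_eq_sqnorm2 => //.
  - exact: L2_cmeasurable.
  - by apply: aeS fg => y ->.
have Lprod j l : L2 (fun y => fourier f y * fourier (Phi j) (y - freq j l)).
  have Lp : L2 (fun y => g y * fourier (Phi j) (y - freq j l)) by exact: L2_indic.
  have mprod : cmeasurable (fun y => fourier f y * fourier (Phi j) (y - freq j l)).
    by apply: cmeasurableM; exact: L2_cmeasurable.
  split => //; rewrite (@ae_eq_sqnorm2 _ _ (fun y => g y * fourier (Phi j) (y - freq j l)))//.
  - by case: Lp.
  - by case: Lp.
  - by apply: aeS fg => y ->.
have := frame f Lf; rewrite nf esum_gabor//.
rewrite (_ : (\int[mu]_y _)%E = (\int[mu]_(y in E) calderon_sum y)%E)//.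
rewrite [RHS]integral_mkcond; apply: ae_eq_integral => //.
- apply: emeasurable_funM; last exact: measurable_calderon_sum.
  by apply: measurable_sqr_cabs_EFin; exact: L2_cmeasurable.
- apply: (measurable_restrictT calderon_sum mE).1.
  exact: (measurable_funS measurableT _ measurable_calderon_sum).
- apply: aeS fg => y -> _; rewrite g2 patchE indicE.
  by case: (_ \in _); rewrite ?mul1e ?mul0e.
Qed.

End gabor_frames.

Theorem theorem3p1 (R : realType) (N : nat) (A B lambda alpha beta : R)
    (Phi : 'I_N -> R -> R[i]) (p0 q0 : 'I_N -> R)
    (N_gt0 : (0 < N)%N) (A_neq0 : A != 0) (lambda_gt0 : 0 < lambda)
    (alpha_gt0 : 0 < alpha) (beta_gt0 : 0 < beta)
    (Phi_L2 : forall j, L2 (Phi j))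
    (Phi_neq0 : forall j, ~ ae_zero (Phi j))
    (Phi_supp : forall j,
       supported_in_interval_of_length (fourier (Phi j)) lambda)
    (p0q0 : forall j, `|p0 j * q0 j| < 1)
    (q0E : forall j, q0 j = 1 / lambda) :
  is_frame_L2 (gabor A B p0 q0 Phi) alpha beta <->
  {ae @lebesgue_measure R, forall gamma : R,
    (alpha%:E <=
     lambda%:E * (\sum_(j < N) \esum_(l in [set: int])
       (cabs (fourier (Phi j) (gamma - A * p0 j * l%:~R)) ^+ 2)%:E)
     <= beta%:E)%E}.
Proof.
split; first exact: calderon_bounds_of_frame.
exact: frame_of_calderon_bounds.
Qed.
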